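(* Let $G$ be a connected semisimple centerfree Lie group without compact factors, $\Gamma$ an irreducible lattice in $G$, and $F=\{g_t:t\in\mathbb{R}\}$ a one-parameter non-quasiunipotent subgroup of $G$. Let $H^+=\{g\in G: g_{-t}gg_t\to e \text{ as } t\to+\infty\}$ and let $\mathcal{F}=\{\Phi_t:t>0\}$, $\Phi_t(h)=g_{-t}hg_t$, viewed as a semigroup of contracting automorphisms of $H^+$. Fix an admissible initial domain $D_0\subset H^+$ for the modified Schmidt game (MSG) induced by $\mathcal{F}$. Then there exists $a''>0$ such that for any $x,z\in G/\Gamma$ and any $a>a''$, the set $$\{h\in H^+: hx\in E(F^+,z)\}$$ is an $a$-winning set for the MSG induced by $\mathcal{F}$.
   Context: $F=\{g_t\}$ is quasiunipotent if all eigenvalues of $\mathrm{Ad}(g_1)$ have modulus $1$, and non-quasiunipotent otherwise. $G$ acts on $G/\Gamma$ by left translations; $F^+=\{g_t:t\ge 0\}$. For $z\in G/\Gamma$, $E(F^+,z)=\{y\in G/\Gamma: z\notin\overline{F^+y}\}$. Modified Schmidt games. Let $H$ be a connected Lie group (here $H=H^+$, which is connected, simply connected and nilpotent) and $\{\Phi_t:t\in\mathbb{R}\}$ a one-parameter group of automorphisms of $H$ such that $\Phi_t$ is contracting for $t>0$ (that is, $\Phi_t^k(h)\to e$ as $k\to\infty$ for every $h\in H$); put $\mathcal{F}=\{\Phi_t:t>0\}$. A set $D_0\subset H$ is admissible if it is compact with non-empty interior. Given an admissible $D_0$, let $\mathcal{D}_t=\{\Phi_t(D_0)h:h\in H\}$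 for $t\in\mathbb{R}$, and fix $a_*$ such that for every $t>a_*$ some element of $\mathcal{D}_t$ is contained in $D_0$ (such $a_*$ exists). For $a,b>a_*$ the game is: Bob picks $t_1\in\mathbb{R}$ and $B_1\in\mathcal{D}_{t_1}$; with $t_k=t_1+(k-1)(a+b)$ and $t_k'=t_k+a$, at step $k\geq 1$ Alice picks $A_k\in\mathcal{D}_{t_k'}$ with $A_k\subset B_k$, and then Bob picks $B_{k+1}\in\mathcal{D}_{t_{k+1}}$ with $B_{k+1}\subset A_k$. The intersection $\bigcap_k A_k=\bigcap_k B_k$ is a single point. A set $S\subset H$ is $(a,b)$-winning if Alice can play so that this point lies in $S$ no matter how Bob plays; $S$ is $a$-winning (where $a>a_*$) if it is $(a,b)$-winning for every $b>a_*$; $S$ is winning if it is $a$-winning for some $a>a_*$. The MSG induced by $\mathcal{F}$ is this game for some fixed admissible $D_0$; the game and the value of $a_*$ depend on $D_0$, but the class of winning sets does not. *)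

(* Defs.v *)
From HB Require Import structures.
From mathcomp Require Import all_boot all_order all_algebra generic_quotient.
From mathcomp Require Import complex.
From mathcomp Require Import all_classical all_reals all_analysis.

Set Implicit Arguments.
Unset Strict Implicit.
Unset Printing Implicit Defensive.

Import Order.TTheory GRing.Theory Num.Theory.
Import numFieldNormedType.Exports.

Local Open Scope classical_set_scope.
Local Open Scope ring_scope.

HB.mixin Record isTopologicalGroup G & Topological G & Group G := {
  mulg_continuous : continuous (fun x : G * G => (x.1 * x.2)%g) ;
  invg_continuous : continuous (fun x : G => (x^-1)%g)
}.

#[short(type="topologicalGroupType")]
HB.structure Definition TopologicalGroup :=
  {G of Topological G & Group G & isTopologicalGroup G}.

Section Subgroups.
Variable G : topologicalGroupType.
Implicit Types H N : set G.

Definition is_subgroup H : Prop :=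
  [/\ H 1%g, (forall x y, H x -> H y -> H (x * y)%g)
    & (forall x, H x -> H (x^-1)%g)].

Definition is_normal N : Prop :=
  is_subgroup N /\ forall g x, N x -> N (g * x * g^-1)%g.

(* For a subgroup, discreteness can be tested at the identity. *)
Definition discrete_subgroup H : Prop :=
  is_subgroup H /\ exists U : set G, [/\ open U, U 1%g & H `&` U = [set 1%g]].

Definition centerfree : Prop :=
  forall z : G, (forall x : G, (x * z)%g = (z * x)%g) -> z = 1%g.

Definition no_compact_factors : Prop :=
  forall N, is_normal N -> connected N -> compact N -> N = [set 1%g].

End Subgroups.

Arguments centerfree : clear implicits.
Arguments no_compact_factors : clear implicits.

Section Smooth.
Variables (R : realType) (m p : nat).

Fixpoint Ck_on (k : nat) (U : set 'rV[R]_m) (f : 'rV[R]_m -> 'rV[R]_p) : Prop :=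
  (forall u, U u -> {for u, continuous f}) /\
  if k is k'.+1 then
    forall i : 'I_m,
      (forall u, U u -> derivable f u (delta_mx 0 i)) /\
      Ck_on k' U ('D_(delta_mx 0 i) f)
  else True.

(* To be used with U open. *)
Definition smooth_on (U : set 'rV[R]_m) (f : 'rV[R]_m -> 'rV[R]_p) : Prop :=
  forall k, Ck_on k U f.

End Smooth.

Section LieGroups.
Variables (R : realType) (n : nat).

(* [chart_inv] is only meaningful on the image of [chart_dom]. *)
Record chart (T : topologicalType) := Chart {
  chart_dom : set T ;
  chart_map : T -> 'rV[R]_n ;
  chart_inv : 'rV[R]_n -> T ;
  chart_dom_open : open chart_dom ;
  chart_img_open : open (chart_map @` chart_dom) ;
  chart_mapK : forall x, chart_dom x -> chart_inv (chart_map x) = x ;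
  chart_map_continuous : {within chart_dom, continuous chart_map} ;
  chart_inv_continuous :
    {within chart_map @` chart_dom, continuous chart_inv}
}.

Definition chart_img (T : topologicalType) (c : chart T) : set 'rV[R]_n :=
  chart_map c @` chart_dom c.

(* The atlas is given as a family of charts indexed by points, the chart of
   index x being defined at x. Pairs of vectors of dimension n are encoded as
   vectors of dimension n + n. *)
Record lie_group (G : topologicalGroupType) := LieGroup {
  chart_at : G -> chart G ;
  chart_at_dom : forall x, chart_dom (chart_at x) x ;
  chart_compat : forall x y,
    smooth_on
      (chart_map (chart_at x) @`
         (chart_dom (chart_at x) `&` chart_dom (chart_at y)))
      (chart_map (chart_at y) \o chart_inv (chart_at x)) ;
  lie_hausdorff : hausdorff_space G ;
  lie_second_countable : @second_countable G ;
  lie_mul_smooth : forall x y z,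
    let mul (w : 'rV[R]_(n + n)) :=
      (chart_inv (chart_at x) (lsubmx w) *
       chart_inv (chart_at y) (rsubmx w))%g in
    smooth_on
      [set w | [/\ chart_img (chart_at x) (lsubmx w),
                   chart_img (chart_at y) (rsubmx w)
                 & chart_dom (chart_at z) (mul w)]]
      (chart_map (chart_at z) \o mul) ;
  lie_inv_smooth : forall x z,
    let inv (u : 'rV[R]_n) := ((chart_inv (chart_at x) u)^-1)%g in
    smooth_on
      [set u | chart_img (chart_at x) u /\ chart_dom (chart_at z) (inv u)]
      (chart_map (chart_at z) \o inv)
}.

Section LieAlgebra.
Variables (G : topologicalGroupType) (L : lie_group G).

(* The Lie algebra, i.e. the tangent space at the identity, is identified with
   'rV[R]_n by means of the chart at the identity. *)
Let c1 := chart_at L 1%g.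

(* The matrix of Ad x; it acts on row vectors on the right. *)
Definition Ad (x : G) : 'M[R]_n :=
  'J (fun u => chart_map c1 (x * chart_inv c1 u * x^-1)%g) (chart_map c1 1%g).

(* [X, Y] = ad X (Y), where ad is the differential of Ad at the identity. *)
Definition lie_bracket (X Y : 'rV[R]_n) : 'rV[R]_n :=
  Y *m 'D_X (fun u => Ad (chart_inv c1 u)) (chart_map c1 1%g).

Definition lie_ideal (I : {vspace 'rV[R]_n}) : Prop :=
  forall X Y, Y \in I -> lie_bracket X Y \in I.

Definition lie_derived (I : {vspace 'rV[R]_n}) : {vspace 'rV[R]_n} :=
  <<[seq lie_bracket X Y | X <- vbasis I, Y <- vbasis I]>>%VS.

Definition lie_solvable (I : {vspace 'rV[R]_n}) : Prop :=
  exists k, iter k lie_derived I = 0%VS.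

Definition semisimple : Prop :=
  forall I, lie_ideal I -> lie_solvable I -> I = 0%VS.

Definition quasiunipotent (g : R -> G) : Prop :=
  forall lambda : R[i],
    eigenvalue (map_mx (real_complex R) (Ad (g 1))) lambda -> `|lambda| = 1.

End LieAlgebra.
End LieGroups.

Section CosetSpace.
Local Open Scope quotient_scope.
Variables (G : topologicalGroupType) (Gamma : set G).

Definition left_coset (x : G) : set G := [set (x * y)%g | y in Gamma].

Definition coset_rel : rel G :=
  fun x y => `[< left_coset x = left_coset y >].

Lemma coset_rel_refl : reflexive coset_rel.
Proof. by move=> x; apply/asboolP. Qed.

Lemma coset_rel_sym : symmetric coset_rel.
Proof. by move=> x y; apply/asboolP/asboolP. Qed.

Lemma coset_rel_trans : transitive coset_rel.
Proof. by move=> y x z /asboolP xy /asboolP yz; apply/asboolP; rewrite xy. Qed.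

Canonical coset_equiv :=
  EquivRel coset_rel coset_rel_refl coset_rel_sym coset_rel_trans.

Definition coset_space : Type :=
  quotient_topology {eq_quot coset_equiv}.

HB.instance Definition _ := Topological.on coset_space.
HB.instance Definition _ := Quotient.on coset_space.
HB.instance Definition _ :=
  isPointed.Build coset_space (\pi_coset_space 1%g).

Definition coset_translate (x : G) (y : coset_space) : coset_space :=
  (\pi_coset_space (x * repr y)%g).

Definition borel_coset_space := g_sigma_algebraType (@open coset_space).

End CosetSpace.

Section Lattices.
Variables (R : realType) (G : topologicalGroupType).
Implicit Types Gamma : set G.

Definition is_lattice Gamma : Prop :=
  discrete_subgroup Gamma /\
  exists mu : {measure set (borel_coset_space Gamma) -> \bar R},
    [/\ (0 < mu [set: borel_coset_space Gamma])%E,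
        (mu [set: borel_coset_space Gamma] < +oo)%E
      & forall (x : G) (A : set (borel_coset_space Gamma)), measurable A ->
          mu (coset_translate x @` A) = mu A].

(* The last clause says that (Gamma `&` H1)(Gamma `&` H2) has finite index in
   Gamma. *)
Definition reducible Gamma : Prop :=
  exists H1 H2 : set G,
    [/\ [/\ is_normal H1, closed H1, connected H1 & H1 <> [set 1%g]],
        [/\ is_normal H2, closed H2, connected H2 & H2 <> [set 1%g]],
        forall x, exists h1 h2, [/\ H1 h1, H2 h2 & x = (h1 * h2)%g],
        discrete_subgroup (H1 `&` H2)
      & exists s : seq G, forall x, Gamma x ->
          exists y h1 h2, [/\ y \in s, (Gamma `&` H1) h1, (Gamma `&` H2) h2
                            & x = (y * (h1 * h2))%g]].

Definition irreducible_lattice Gamma : Prop :=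
  is_lattice Gamma /\ ~ reducible Gamma.

End Lattices.

Section Flows.
Variables (R : realType) (G : topologicalGroupType).
Implicit Types g : R -> G.

Definition one_parameter_subgroup g : Prop :=
  continuous g /\ forall s t, g (s + t) = (g s * g t)%g.

Definition conj_flow g (t : R) (h : G) : G := (g (- t) * h * g t)%g.

Definition expanding_horospherical g : set G :=
  [set h | conj_flow g t h @[t --> +oo] --> (1%g : G)].

Definition forward_orbit (Gamma : set G) g (y : coset_space Gamma) :
    set (coset_space Gamma) :=
  [set coset_translate (g t) y | t in [set t : R | 0 <= t]].

Definition escaping (Gamma : set G) g (z : coset_space Gamma) :
    set (coset_space Gamma) :=
  [set y | ~ closure (forward_orbit g y) z].

End Flows.

Section ModifiedSchmidtGames.
Variables (R : realType) (G : topologicalGroupType).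
(* The group in which the game is played is a subgroup H of G with the induced
   topology, and Phi restricts to a one-parameter group of automorphisms
   of H. *)
Variables (H : set G) (Phi : R -> G -> G) (D0 : set G).

(* Compactness does not depend on the ambient space; the interior is taken
   in H. *)
Definition admissible : Prop :=
  [/\ D0 `<=` H, compact D0
    & exists U : set G, [/\ open U, H `&` U !=set0 & H `&` U `<=` D0]].

Definition msg_domains (t : R) : set (set G) :=
  [set [set (Phi t d * h)%g | d in D0] | h in H].

Definition msg_threshold (astar : R) : Prop :=
  forall t, astar < t -> exists2 B, msg_domains t B & B `<=` D0.

Section Play.
Variables (a b t1 : R).

(* Stages are numbered from 0. *)
Definition msg_time (k : nat) : R := t1 + k%:R * (a + b).

Definition bob_legal (A B : nat -> set G) (k : nat) : Prop :=
  msg_domains (msg_time k) (B k) /\ (if k is j.+1 then B k `<=` A j else True).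

Definition alice_legal (A B : nat -> set G) (k : nat) : Prop :=
  msg_domains (msg_time k + a) (A k) /\ A k `<=` B k.

End Play.

(* A strategy of Alice maps the initial parameter t1 and the list of the
   moves of Bob up to stage k to her move at stage k. It has to provide a legal
   move as long as Bob has played legally, and the outcome has to be in S. *)
Definition ab_winning (a b : R) (S : set G) : Prop :=
  exists sigma : R -> seq (set G) -> set G,
    forall (t1 : R) (B : nat -> set G),
      let A k := sigma t1 (mkseq B k.+1) in
      (forall k, (forall j, (j <= k)%N -> bob_legal a b t1 A B j) ->
         alice_legal a b t1 A B k) /\
      ((forall k, bob_legal a b t1 A B k) ->
         exists2 p, \bigcap_k A k = [set p] & S p).

Definition a_winning (astar a : R) (S : set G) : Prop :=
  astar < a /\ forall b, astar < b -> ab_winning a b S.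

End ModifiedSchmidtGames.

(* Main.v *)
(* On lifts to G, a return to a neighbourhood of z Gamma at time t - s (s >= 0)
   of a point p = Phi_t(d) h reads g_(-s) d y = w z gamma with y = g_t h x.
   For two returns with the same gamma, g_(-s) c g_s' with c = d d'^-1 is close
   to 1; as the flow meets H only at 1, c is then close to 1, so that one gamma
   accounts for one small patch of d's. Backwards in time conjugation by the
   flow contracts H, so by discreteness of Gamma only boundedly many gammas
   occur per unit of time: over a window of length T there are O(T) patches.
   For a large, Alice has two admissible moves that no patch meets
   simultaneously, so each of her moves can halve the number of patches that
   are met. Playing in blocks of m moves, with 2 ^ m larger than the number of
   patches for the time window of length O(m) ending at the start of the block,
   she avoids them all.

   This needs H <> 1. If all eigenvalues of Ad g_1 had modulus at most 1 and one
   of them modulus less than 1, the vectors contracted exponentially by Ad g_1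
   would span a nonzero solvable ideal. So there is an eigenvalue of maximal
   modulus mu > 1, and an eigenvector v. In the chart at 1, psi = conjugation by
   g_m is linear up to a quadratic error, and since |Ad(g_m)| < (mu ^ m) ^ 2 for
   m large, psi ^ k (Ad(g_m) ^ - k v) stays close to v for v small; a limit
   point of this sequence is a nontrivial element of H. *)
Require Import Defs.
From HB Require Import structures.
From mathcomp Require Import all_boot all_order all_algebra generic_quotient.
From mathcomp Require Import complex.
From mathcomp Require Import all_classical all_reals all_analysis.
From mathcomp Require Import ring lra.
Import Order.TTheory GRing.Theory Num.Theory.
Import numFieldNormedType.Exports.
Local Open Scope classical_set_scope.
Local Open Scope ring_scope.

Set Implicit Arguments.
Unset Strict Implicit.
Unset Printing Implicit Defensive.

(** * Topological groups *)

Section TopologicalGroups.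
Variable G : topologicalGroupType.
Implicit Types (x y z h : G) (U V W K : set G).

Lemma cvgMg T (F : set_system T) {FF : Filter F} (f h : T -> G) (a b : G) :
  f @ F --> a -> h @ F --> b -> (fun t => f t * h t)%g @ F --> (a * b)%g.
Proof.
move=> fa hb; apply: (@cvg_comp _ _ _ (fun t => (f t, h t))
  (fun p : G * G => p.1 * p.2)%g); last exact: (mulg_continuous (a, b)).
exact: cvg_pair.
Qed.

Lemma cvgVg T (F : set_system T) {FF : Filter F} (f : T -> G) (a : G) :
  f @ F --> a -> (fun t => (f t)^-1)%g @ F --> (a^-1)%g.
Proof. by move=> fa; apply: cvg_comp fa (@invg_continuous G a). Qed.

Lemma mulgr_continuous y : continuous (fun x => x * y)%g.
Proof. by move=> x; apply: cvgMg; [exact: cvg_id|exact: cvg_cst]. Qed.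

(** Continuity at 1 is used twice, for quotients and then for products. Expressions of this shape
    arise when an equality between two quotients is rearranged. *)
Lemma nbhs1_small W : nbhs (1%g : G) W ->
  exists2 V, nbhs (1%g : G) V & forall a b c d, V a -> V b -> V c -> V d ->
    W (a^-1 * b * (c^-1 * d))%g.
Proof.
move=> nW.
have split2 (X : set G) : nbhs (1%g : G) X -> exists2 V, nbhs (1%g : G) V &
    forall a b, V a -> V b -> X (a^-1 * b)%g.
  move=> nX; have : \forall p \near ((1%g : G), (1%g : G)), X (p.1^-1 * p.2)%g.
    have h1 : (fun p : G * G => p.1) @ nbhs ((1%g : G), (1%g : G)) --> (1%g : G).
      exact: cvg_fst.
    have h2 : (fun p : G * G => p.2) @ nbhs ((1%g : G), (1%g : G)) --> (1%g : G).
      exact: cvg_snd.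
    have := cvgMg (cvgVg h1) h2.
    by rewrite !(invg1, mulg1); apply.
  move=> [[A B] [/= nA nB] sAB]; exists (A `&` B); first exact: filterI.
  by move=> a b [Aa _] [_ Bb]; exact: (sAB (a, b)).
have [V1 nV1 V1W] : exists2 V, nbhs (1%g : G) V & 
    forall a b, V a -> V b -> W (a * b)%g.
  have : \forall p \near ((1%g : G), (1%g : G)), W (p.1 * p.2)%g.
    have := @mulg_continuous G ((1%g : G), (1%g : G)).
    by rewrite /continuous_at/= mulg1; apply.
  move=> [[A B] [/= nA nB] sAB]; exists (A `&` B); first exact: filterI.
  by move=> a b [Aa _] [_ Bb]; exact: (sAB (a, b)).
have [V nV VV1] := split2 _ nV1.
by exists V => // a b c d *; apply: V1W; apply: VV1.
Qed.

Lemma nbhs1_smallV W : nbhs (1%g : G) W ->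
  exists2 V, nbhs (1%g : G) V & forall a b, V a -> V b -> W (a * b^-1)%g.
Proof.
move=> /nbhs1_small[V nV VW].
exists (V `&` [set x | V x^-1%g]).
  apply: filterI => //.
  by have := @invg_continuous G 1%g; rewrite /continuous_at/= invg1; apply.
move=> a b [_ /= Va] [Vb _].
have := VW _ _ _ _ Va (nbhs_singleton nV) Vb (nbhs_singleton nV).
by rewrite invgK !mulg1.
Qed.

Lemma nbhs_translate1 x W : nbhs x W <-> nbhs (1%g : G) [set u | W (u * x)%g].
Proof.
split=> [nW|nW].
  by have := @mulgr_continuous x 1%g; rewrite /continuous_at/= mul1g; apply.
have := @mulgr_continuous x^-1%g x; rewrite /continuous_at/= mulgV => /(_ _ nW) h.
have {}h : nbhs x [set y | W (y * x^-1 * x)%g] by exact: h.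
by apply: filterS h => y /=; rewrite mulgVK.
Qed.

(** A point y of the closure of V x has a point of V x in V y, so that y lies in V^-1 V x. *)
Lemma topological_group_regular x W : nbhs x W ->
  exists2 V, nbhs x V & closure V `<=` W.
Proof.
move=> /nbhs_translate1 nW; have [V nV VW] := nbhs1_small nW.
exists [set y | V (y * x^-1)%g].
  by apply/nbhs_translate1; apply: filterS nV => y /=; rewrite mulgK.
move=> y clV; have /clV[y' [Vy' /= Vu]] : nbhs y [set y' | V (y' * y^-1)%g].
  by apply/nbhs_translate1; apply: filterS nV => u /=; rewrite mulgK.
have := VW _ _ _ _ Vu Vy' (nbhs_singleton nV) (nbhs_singleton nV).
by rewrite /= invg1 mulg1 mulg1 invgM invgK !mulgA !mulgVK.
Qed.

End TopologicalGroups.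

(** * Contraction along the flow *)

Section Contraction.
Variables (R : realType) (G : topologicalGroupType) (g : R -> G).
Hypotheses (hG : hausdorff_space G) (hg : one_parameter_subgroup g).
Local Notation Phi := (conj_flow g).
Local Notation H := (expanding_horospherical g).

Lemma one_parameter0 : g 0 = 1%g.
Proof.
have := hg.2 0 0; rewrite addr0 => e.
apply: (mulgI (g 0)); rewrite mulg1; exact/esym.
Qed.

Lemma one_parameterN t : g (- t) = (g t)^-1%g.
Proof. by apply/esym/mulg1_eq; rewrite -hg.2 subrr one_parameter0. Qed.

Lemma conj_flow1 t : Phi t 1%g = 1%g.
Proof. by rewrite /conj_flow mulg1 one_parameterN mulVg. Qed.

Lemma conj_flowM t x y : Phi t (x * y)%g = (Phi t x * Phi t y)%g.
Proof. by rewrite /conj_flow one_parameterN !mulgA mulgK. Qed.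

Lemma conj_flowV t x : Phi t x^-1%g = (Phi t x)^-1%g.
Proof. by rewrite /conj_flow one_parameterN !invgM !invgK !mulgA. Qed.

Lemma conj_flow0 x : Phi 0 x = x.
Proof. by rewrite /conj_flow oppr0 one_parameter0 mul1g mulg1. Qed.

Lemma conj_flowD s t x : Phi (s + t) x = Phi s (Phi t x).
Proof. by rewrite /conj_flow opprD [s + t]addrC !hg.2 !mulgA. Qed.

Lemma conj_flowK t : cancel (Phi t) (Phi (- t)).
Proof. by move=> x; rewrite -conj_flowD addNr conj_flow0. Qed.

Lemma cvg_conj_flow T (F : set_system T) {FF : Filter F} (s : T -> R)
    (f : T -> G) (a : R) (b : G) :
  s @ F --> a -> f @ F --> b -> (fun t => Phi (s t) (f t)) @ F --> Phi a b.
Proof.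
move=> sa fb; apply: cvgMg; last exact: (cvg_comp _ _ sa (hg.1 a)).
apply: cvgMg => //.
by apply: (cvg_comp (fun t => - s t) g _ (hg.1 (- a))); exact: cvgN.
Qed.

Lemma conj_flow_continuous t : continuous (Phi t).
Proof. by move=> x; apply: cvg_conj_flow; [exact: cvg_cst|exact: cvg_id]. Qed.

Lemma horoM x y : H x -> H y -> H (x * y)%g.
Proof.
move=> Hx Hy; have : (Phi t x * Phi t y)%g @[t --> +oo] --> (1 * 1 : G)%g.
  exact: cvgMg.
rewrite mulg1 => h.
by rewrite /expanding_horospherical /mkset (eq_cvg _ _ (fun t => conj_flowM t x y)).
Qed.

Lemma horoV x : H x -> H x^-1%g.
Proof.
move=> Hx; have : (Phi t x)^-1%g @[t --> +oo] --> (1^-1 : G)%g by exact: cvgVg.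
rewrite invg1 => h.
by rewrite /expanding_horospherical /mkset (eq_cvg _ _ (fun t => conj_flowV t x)).
Qed.

Lemma horo_conj_flow t x : H x -> H (Phi t x).
Proof.
move=> Hx; have : Phi t (Phi s x) @[s --> +oo] --> Phi t 1%g.
  by apply: cvg_conj_flow => //; exact: cvg_cst.
rewrite conj_flow1 => h.
have e s : Phi s (Phi t x) = Phi t (Phi s x).
  by rewrite -conj_flowD addrC conj_flowD.
by rewrite /expanding_horospherical /mkset (eq_cvg _ _ e).
Qed.

(* [g] meets [H] only at 1: its elements are fixed by every [Phi t]. *)
Lemma horo_g1 t : H (g t) -> g t = 1%g.
Proof.
move=> Hg; suff: g t @[_ --> pinfty_nbhs R] --> (1%g : G).
  move=> c1; exact: (cvg_unique _ (cvg_cst _) c1).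
have e s : Phi s (g t) = g t.
  by rewrite /conj_flow -!hg.2 addrAC addNr add0r.
by rewrite -(eq_cvg _ _ e).
Qed.

Lemma horo_transverse s t c : H c -> (g (- s) * c * g t)%g = 1%g -> c = 1%g.
Proof.
move=> Hc e; have ec : c = g (s - t).
  rewrite hg.2 !one_parameterN -[c](mulKg (g s)^-1%g) invgK; congr (_ * _)%g.
  by rewrite -one_parameterN -[LHS](mulgK (g t)) e mul1g.
by rewrite ec horo_g1// -ec.
Qed.

Variable D0 : set G.
Hypothesis hD0 : admissible H D0.

(** A Baire category argument. Every h in H lies in one of the closed sets [Km m] of points whose
    orbit stays in [closure W0] from time m on, so some [Km m] contains a nonempty relatively open
    part of H, and quotients of its points fill a neighbourhood of 1 in H. The compactness of D0
    takes the place of completeness. *)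
Lemma horo_contract_near1 W : nbhs (1%g : G) W ->
  exists T, \forall h \near (1%g : G), H h -> forall t, T <= t -> W (Phi t h).
Proof.
move=> /nbhs1_smallV[W1 nW1 W1W].
have [W0 nW0 clW0] := topological_group_regular nW1.
have [D0H D0c [U0 [U0o U0n U0D]]] := hD0.
pose Km (m : nat) := [set h | forall t, m%:R <= t -> closure W0 (Phi t h)].
have Kmc m : closed (Km m).
  have -> : Km m = \bigcap_(t in [set t | m%:R <= t])
      (Phi t @^-1` closure W0).
    by apply/seteqP; split=> h hh t; exact: hh.
  apply: closed_bigI => t _; apply: closed_comp; last exact: closed_closure.
  by move=> ? _; exact: conj_flow_continuous.
have [m [U [Uo [h0 [Hh0 Uh0]] HUK]]] : exists m U, [/\ open U, H `&` U !=set0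
    & H `&` U `<=` Km m].
  apply: contrapT => bad.
  pose P (U : set G) := [/\ open U, H `&` U !=set0 & U `<=` U0].
  have step (m : nat) (U : set G) : P U ->
      exists2 U', P U' & closure U' `<=` U `\` Km m.
    move=> [Uo Un UU0].
    have [h [Hh Uh] nK] : exists2 h, (H `&` U) h & ~ Km m h.
      apply: contrapT => nh; apply: bad; exists m, U; split => // h hh.
      by apply: contrapT => nK; apply: nh; exists h.
    have : nbhs h (U `\` Km m).
      apply: open_nbhs_nbhs; split; last by split.
      by apply: openI => //; rewrite openC.
    move=> /topological_group_regular[V nV clV].
    move: nV; rewrite nbhsE => -[U' [U'o U'h] U'V].
    exists U'; last by apply: subset_trans clV; exact: closure_subset.
    split=> //; first by exists h.
    move=> u /U'V Vu; apply: UU0.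
    by have [] := clV _ (subset_closure Vu).
  have PU0 : P U0 by split.
  (* If no [Km m] had interior in H, dependent choice would give open sets [O m] meeting H, with the
     closure of each inside the previous one and off [Km m]. *)
  pose next (m : nat) (U : {U | P U}) : {U | P U} :=
    let: exist2 U' PU' _ := cid2 (step m _ (projT2 U)) in exist _ U' PU'.
  pose fix O (m : nat) : {U | P U} :=
    if m is m'.+1 then next m' (O m') else exist _ U0 PU0.
  have nextP m U : closure (projT1 (next m U)) `<=` projT1 U `\` Km m.
    by rewrite /next; case: cid2.
  have Ole m p : projT1 (O (m + p)%N) `<=` projT1 (O m).
    elim: p => [|p IH]; first by rewrite addn0.
    rewrite addnS; apply: subset_trans IH => u Ou.
    by have [] := nextP _ _ _ (subset_closure Ou).
  pose F := filter_from [set: nat] (fun m => H `&` projT1 (O m)).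
  have FF : ProperFilter F.
    apply: filter_from_proper; last by move=> m _; case: (projT2 (O m)).
    apply: filter_from_filter; first by exists 0%N.
    move=> i j _ _; exists (i + j)%N => // u [Hu Ou]; split; split=> //.
      exact: Ole Ou.
    by move: Ou; rewrite addnC; exact: Ole.
  (* The traces of the [O m] on H lie in D0, as [O m] is inside U0. A cluster point of them is in
     every closure, hence in no [Km m], although its orbit tends to 1. *)
  have [q [Dq cq]] : D0 `&` cluster F !=set0.
    by apply: D0c; exists 0%N.
  have nKq m : ~ Km m q.
    have /nextP[//] : closure (projT1 (next m (O m))) q.
    move=> B nB; have [u [[_ Ou] Bu]] := cq _ _ 
      (ex_intro2 _ _ m.+1 I (fun _ => id)) nB.
    by exists u.
  have := D0H _ Dq; rewrite /expanding_horospherical/= => /(_ _ nW0).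
  move=> [M [_ hM]]; pose m := (Num.truncn `|M|).+1.
  apply: (nKq m) => t mt; apply: subset_closure; apply: hM.
  apply: lt_le_trans mt; apply: le_lt_trans (ler_norm M) _.
  by rewrite /m; exact: truncnS_gt.
(* For h near 1 in H, both h h0 and h0 lie in [Km m], and h is their quotient. *)
exists m%:R.
have : nbhs (1%g : G) [set u | U (u * h0)%g].
  by apply: (proj1 (nbhs_translate1 _ _)); exact: open_nbhs_nbhs.
apply: filterS => h /= Uh Hh t mt.
have h0K : Km m h0 by exact: HUK.
have hK : Km m (h * h0)%g by apply: HUK; split => //; exact: horoM.
have := W1W _ _ (clW0 _ (hK t mt)) (clW0 _ (h0K t mt)).
by rewrite conj_flowM mulgK.
Qed.

(** For k' near k, split Phi_t(k') as Phi_t(k' k^-1) Phi_t(k). The first factor is small uniformly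
    in k' by [horo_contract_near1], the second by convergence at the single point k; compactness of
    K makes the time uniform. *)
Lemma horo_contract_compact K W : compact K -> K `<=` H ->
  nbhs (1%g : G) W -> exists T, forall t k, T <= t -> K k -> W (Phi t k).
Proof.
move=> cK KH /nbhs1_smallV[W1 nW1 W1W].
have [T hT] := horo_contract_near1 nW1.
have : \forall t \near +oo, K `<=` (fun k => W (Phi t k)).
  apply: (proj2 (near_covering_withinP K)
    (proj1 (compact_near_coveringP K) cK) _ _ (fun t k => W (Phi t k))).
  move=> k Kk.
  have Hk : H k^-1%g by exact/horoV/KH.
  have n1 : \forall k' \near k, K k' -> forall t, T <= t -> W1 (Phi t (k' * k^-1)%g).
    apply/nbhs_translate1; apply: filterS hT => h hh /= Khk.
    by rewrite mulgK; apply: hh; rewrite -(mulgK k h); apply: horoM => //; exact: KH.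
  have n2 : \forall t \near +oo, T <= t /\ W1 (Phi t k^-1%g).
    by near=> t; split; near: t; [apply: nbhs_pinfty_ge; exact: num_real|exact: (Hk _ nW1)].
  near=> k' t => Kk'.
  have [Tt W1k] : T <= t /\ W1 (Phi t k^-1%g) by near: t.
  have W1k' : W1 (Phi t (k' * k^-1)%g).
    have : K k' -> forall t, T <= t -> W1 (Phi t (k' * k^-1)%g) by near: k'.
    by move=> /(_ Kk'); exact.
  have := W1W _ _ W1k' W1k.
  by rewrite conj_flowM conj_flowV invgK mulgVK.
move=> [M [_ hM]]; exists (M + 1) => t k Mt Kk; apply: (hM t) => //.
by apply: lt_le_trans Mt; rewrite ltrDl.
Unshelve. all: by end_near. Qed.

End Contraction.

(** * Transversality and discreteness *)

Section Pieces.
Variables (R : realType) (G : topologicalGroupType) (g : R -> G).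
Hypotheses (hG : hausdorff_space G) (hg : one_parameter_subgroup g).
Local Notation Phi := (conj_flow g).
Local Notation H := (expanding_horospherical g).
Variable D0 : set G.
Hypothesis hD0 : admissible H D0.

Lemma nbhs1_neq (x : G) : x <> 1%g -> \forall y \near (1%g : G), y <> x.
Proof.
move=> x1; apply: (@open_nbhs_nbhs _ (1%g : G) (~` [set x])).
split; last by move=> /= /esym.
by rewrite openC; apply: accessible_closed_set1; exact: hausdorff_accessible.
Qed.

(** Two distinct interior points u1, u2 of D0 are fixed first. For a large the translates of
    Phi_a(D0) shrink to u1 and u2, so quotients between the two pieces stay near u1 u2^-1, while v1
    v2^-1 is near 1. If one patch V q met both pieces, such a quotient would have the form v1
    v2^-1. *)
Lemma horo_two_pieces : (exists2 h, H h & h <> 1%g) ->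
  exists V a0, nbhs (1%g : G) V /\ forall a, a0 <= a -> exists c1 c2,
    [/\ H c1, H c2,
        forall d, D0 d -> D0 (Phi a d * c1)%g /\ D0 (Phi a d * c2)%g
      & forall d1 d2 v1 v2, D0 d1 -> D0 d2 -> V v1 -> V v2 ->
        ((Phi a d1 * c1) * (Phi a d2 * c2)^-1 <> v1 * v2^-1)%g].
Proof.
move=> [h Hh h1]; have [D0H D0c [U0 [U0o [u1 [Hu1 Uu1]] U0D]]] := hD0.
have D1 : D0 u1 by exact: U0D.
have [u2 [Hu2 Uu2 u12]] : exists u2, [/\ H u2, U0 u2 & u2 <> u1].
  have nU : nbhs (1%g : G) [set u | U0 (u * u1)%g].
    by apply: (proj1 (nbhs_translate1 _ _)); exact: open_nbhs_nbhs.
  have [M [_ /(_ (M + 1))/= hM]] := Hh _ nU.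
  (* A nontrivial element of H, contracted far enough, moves u1 within U0; the result differs from
     u1 because Phi_t is injective. *)
  exists (Phi (M + 1) h * u1)%g; split.
  - by apply: horoM => //; exact: horo_conj_flow.
  - by apply: hM; rewrite ltrDl.
  - move=> /(congr1 (fun x => x * u1^-1)%g); rewrite mulgK mulgV => e.
    by apply: h1; rewrite -(conj_flowK hg (M + 1) h) e conj_flow1.
have [V nV VW] : exists2 V, nbhs (1%g : G) V &
    forall a b c d, V a -> V b -> V c -> V d ->
      (a^-1 * b * (c^-1 * d) <> u1 * u2^-1)%g.
  apply: (@nbhs1_small _ (fun x => x <> (u1 * u2^-1)%g)); apply: nbhs1_neq.
  by move=> /divg1_eq /esym.
have nU u : U0 u -> nbhs (1%g : G) [set x | U0 (x * u)%g].
  by move=> Uu; apply: (proj1 (nbhs_translate1 _ _)); exact: open_nbhs_nbhs.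
have cD : compact [set (d * u1^-1)%g | d in D0].
  apply: continuous_compact => //; apply: continuous_subspaceT.
  exact: mulgr_continuous.
have DH : [set (d * u1^-1)%g | d in D0] `<=` H.
  by move=> _ [d Dd <-]; apply: horoM => //; [exact: D0H|exact: horoV].
have [a0 ha0] := horo_contract_compact hg hD0 cD DH
  (filterI nV (filterI (nU _ Uu1) (nU _ Uu2))).
exists V, a0; split => // a aa0.
have alg (x1 x2 u w b c : G) : (x1 * u * (w * x2^-1) = b * c^-1)%g ->
    (x1^-1 * b * (c^-1 * x2) = u * w)%g.
  by move=> eq; rewrite mulgA -(mulgA _ b) -eq !mulgA mulVg mul1g mulgVK.
have key d : D0 d -> [/\ V (Phi a (d * u1^-1)%g),
    U0 (Phi a (d * u1^-1)%g * u1)%g & U0 (Phi a (d * u1^-1)%g * u2)%g].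
  by move=> Dd; have [|? []] := ha0 a (d * u1^-1)%g aa0; [exists d|].
have e d u : (Phi a d * ((Phi a u1)^-1 * u) = Phi a (d * u1^-1) * u)%g.
  by rewrite conj_flowM// conj_flowV// mulgA.
(* These shifts send the image Phi_a(u1) exactly to u1 and to u2. *)
exists ((Phi a u1)^-1 * u1)%g, ((Phi a u1)^-1 * u2)%g; split.
- by apply: horoM => //; apply: horoV => //; exact: horo_conj_flow.
- by apply: horoM => //; apply: horoV => //; exact: horo_conj_flow.
- move=> d Dd; rewrite !e; have [_ ? ?] := key _ Dd.
  have Hd : H (Phi a (d * u1^-1)%g).
    by apply: horo_conj_flow => //; apply: DH; exists d.
  by split; apply: U0D; split => //; exact: horoM.
- move=> d1 d2 v1 v2 /key[k1 _ _] /key[k2 _ _] Vv1 Vv2.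
  rewrite !e invgM => eq; apply: (VW _ _ _ _ k1 Vv1 Vv2 k2).
  exact: alg eq.
Qed.

(** The quantitative form of [horo_transverse]: at parameters with c outside an open part of V the
    product differs from 1, hence is separated from 1 locally, and by compactness of the parameter
    set uniformly. *)
Lemma horo_transverse_near M K V : compact K -> K `<=` H ->
  nbhs (1%g : G) V -> exists2 O, nbhs (1%g : G) O & forall (s t : R) c,
    0 <= s <= M -> 0 <= t <= M -> K c -> O (g (- s) * c * g t)%g -> V c.
Proof.
move=> cK KH nV.
have [V' [V'o V'1] V'V] : exists2 B, open_nbhs (1%g : G) B & B `<=` V.
  by move: nV; rewrite nbhsE.
pose K3 := (`[0, M] `*` `[0, M]) `*` K.
have cK3 : compact K3.
  apply: compact_setX => //; apply: compact_setX; exact: segment_compact.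
pose P (o : G) (x : R * R * G) := V' x.2 \/ (g (- x.1.1) * x.2 * g x.1.2)%g <> o.
have : \forall o \near (1%g : G), K3 `<=` P o.
  apply: (proj1 (compact_near_coveringP K3) cK3).
  move=> [[s t] c] [/= _ Kc].
  have [V'c|nV'c] := pselect (V' c).
    have n1 : \forall x \near (s, t, c), V' x.2.
      by apply: (@cvg_snd _ _ (nbhs (s, t)) (nbhs c)); exact: open_nbhs_nbhs.
    by near=> x o; left => /=; near: x.
  pose f (x : R * R * G) := (g (- x.1.1) * x.2 * g x.1.2)%g.
  have fc : f @ nbhs (s, t, c) --> f (s, t, c).
    have c1 : (fun x : R * R * G => x.1.1) @ nbhs (s, t, c) --> s.
      by apply: cvg_comp; [exact: cvg_fst|exact: cvg_fst].
    have c2 : (fun x : R * R * G => x.1.2) @ nbhs (s, t, c) --> t.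
      by apply: cvg_comp; [exact: cvg_fst|exact: cvg_snd].
    have c3 : (fun x : R * R * G => x.2) @ nbhs (s, t, c) --> c.
      exact: cvg_snd.
    apply: cvgMg; last exact: (cvg_comp _ _ c2 (hg.1 t)).
    apply: cvgMg => //.
    by apply: (cvg_comp (fun x : R * R * G => - x.1.1) g _ (hg.1 (- s))); exact: cvgN.
  have f1 : f (s, t, c) != 1%g.
    apply/eqP => /= f1; apply: nV'c.
    by rewrite (horo_transverse hG hg (KH _ Kc) f1).
  move: hG; rewrite open_hausdorff => /(_ _ _ f1)[[A B]] /= [fA B1] [Ao Bo AB].
  have nA : \forall x \near (s, t, c), A (f x).
    by apply: fc; apply: open_nbhs_nbhs; split => //; exact: set_mem.
  have nB : \forall o \near (1%g : G), B o.
    by apply: open_nbhs_nbhs; split => //; exact: set_mem.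
  near=> x o; right => /= fo.
  suff : (set0 : set G) o by [].
  by rewrite -(eqP AB); split; [rewrite -fo; near: x|near: o].
move=> hO; exists [set o | K3 `<=` P o]; first exact: hO.
move=> s t c s0 t0 Kc /(_ (s, t, c)).
by case; [split => //=; rewrite !in_itv/=|move=> /V'V|].
Unshelve. all: by end_near. Qed.

(** The equation gives y = z^-1 o^-1 k o1 z, which is close to z^-1 k0 z when k is close to k0 and
    o, o1 are close to 1. A small neighbourhood of that point contains at most one element of Gamma,
    and finitely many k0 suffice. *)
Lemma discrete_near_finite (Gamma : set G) (z : G) (K : set G) :
  discrete_subgroup Gamma -> compact K ->
  exists2 O, nbhs (1%g : G) O & exists s : seq G, forall o o1 k y,
    O o -> O o1 -> K k -> Gamma y -> (o * z * y = k * o1 * z)%g -> y \in s.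
Proof.
move=> [[G1 GM GV] [U [Uo U1 GU]]] cK.
have nU : nbhs (1%g : G) U by exact: open_nbhs_nbhs.
have [V nV VU] := nbhs1_smallV nU.
(* Along this filter a list is eventually larger than any given one. It lets the compactness of K
   merge the local lists into a single list. *)
pose F := filter_from [set: seq G] (fun s0 => [set s : seq G | {subset s0 <= s}]).
have FF : Filter F.
  apply: filter_from_filter; first by exists [::].
  move=> s1 s2 _ _; exists (s1 ++ s2) => // s hs.
  by split=> x xs; apply: hs; rewrite mem_cat xs ?orbT.
pose P (i : seq G * (G * G)) (k : G) := forall y, Gamma y ->
  (i.2.1 * z * y = k * i.2.2 * z)%g -> y \in i.1.
have : \forall i \near filter_prod F (nbhs ((1%g : G), (1%g : G))), K `<=` P i.
  apply: (proj1 (compact_near_coveringP K) cK) => k0 _.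
  pose p0 := (z^-1 * k0 * z)%g.
  pose N := [set p | V (p * p0^-1)%g].
  have nN : nbhs p0 N.
    by apply/nbhs_translate1; apply: filterS nV => u /=; rewrite /N/= mulgK.
  pose f (x : G * (G * G)) := (z^-1 * x.2.1^-1 * x.1 * x.2.2 * z)%g.
  have fc : f @ nbhs (k0, ((1%g : G), (1%g : G))) --> p0.
    have c1 : (fun x : G * (G * G) => x.1) @
        nbhs (k0, ((1%g : G), (1%g : G))) --> k0 by exact: cvg_fst.
    have c2 : (fun x : G * (G * G) => x.2.1) @
        nbhs (k0, ((1%g : G), (1%g : G))) --> (1%g : G).
      by apply: cvg_comp; [exact: cvg_snd|exact: cvg_fst].
    have c3 : (fun x : G * (G * G) => x.2.2) @
        nbhs (k0, ((1%g : G), (1%g : G))) --> (1%g : G).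
      by apply: cvg_comp; [exact: cvg_snd|exact: cvg_snd].
    have -> : p0 = (z^-1 * 1^-1 * k0 * 1 * z)%g by rewrite invg1 !mulg1.
    apply: cvgMg; last exact: cvg_cst.
    apply: cvgMg => //; apply: cvgMg => //; apply: cvgMg; first exact: cvg_cst.
    exact: cvgVg.
  have [s0 hs0] : exists s0 : seq G, forall y, Gamma y -> N y -> y \in s0.
    have [[y0 [Gy0 Ny0]]|no] := pselect (exists y0, Gamma y0 /\ N y0); last first.
      by exists [::] => y Gy Ny; case: no; exists y.
    exists [:: y0] => y Gy Ny; rewrite inE; apply/eqP/divg1_eq.
    have : (Gamma `&` U) (y * y0^-1)%g.
      split; first by apply: GM => //; exact: GV.
      by have := VU _ _ Ny Ny0; rewrite mulgKA.
    by rewrite GU.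
  have nf : \forall x \near (k0, ((1%g : G), (1%g : G))), N (f x) by exact: fc.
  move: nf => [[A B] [/= nA nB] AB].
  exists (A, [set s : seq G | {subset s0 <= s}] `*` B) => /=.
    split=> //; exists ([set s : seq G | {subset s0 <= s}], B) => //=.
    by split => //; exists s0.
  move=> [k [s [w w1]]] /= [Ak [ss0 Bo]] y Gy /= e; apply: ss0.
  apply: hs0 => //; have := AB (k, (w, w1)) (conj Ak Bo); rewrite /f/=.
  by rewrite -!mulgA (mulgA k) -e !mulgA mulgVK mulVg mul1g.
move=> [[A B] [/= [s0 _ sA] [[B1 B2] /= [nB1 nB2] sB]] sAB].
exists (B1 `&` B2); first exact: filterI.
exists s0 => o o1 k y [Bo _] [_ Bo1] Kk Gy e.
by apply: (sAB (s0, (o, o1)) _ k Kk y Gy e); split; [apply: sA|apply: sB].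
Qed.

End Pieces.

(** * Patches of returning points *)

Section Patches.
Variables (R : realType) (G : topologicalGroupType) (g : R -> G).
Hypotheses (hG : hausdorff_space G) (hg : one_parameter_subgroup g).
Local Notation Phi := (conj_flow g).
Local Notation H := (expanding_horospherical g).
Variable D0 : set G.
Hypothesis hD0 : admissible H D0.

Let C : set G := [set (x.1 * x.2^-1)%g | x in D0 `*` D0].

Let C_compact : compact C.
Proof.
have [_ D0c _] := hD0.
apply: continuous_compact; last exact: compact_setX.
apply: continuous_subspaceT => -[x y]; apply: cvgMg; first exact: cvg_fst.
by apply: cvgVg; exact: cvg_snd.
Qed.

Let C_horo : C `<=` H.
Proof.
have [D0H _ _] := hD0; move=> _ [[x y] [/= Dx Dy] <-].
by apply: horoM => //; [exact: D0H|apply: horoV => //; exact: D0H].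
Qed.

(* Backwards in time [C] is contracted, so that the compact set does not depend
   on [t]. *)
Lemma backward_compact : exists2 K : set G, compact K & forall (s t : R) c,
  0 <= t -> `|t - s| <= 1 -> C c -> K (g (- s) * c * g t)%g.
Proof.
have [_ D0c [U0 [U0o [u1 [Hu1 Uu1]] U0D]]] := hD0.
have nU : nbhs (1%g : G) [set x | U0 (x * u1)%g].
  by apply: (proj1 (nbhs_translate1 _ _)); exact: open_nbhs_nbhs.
have [T hT] := horo_contract_compact hg hD0 C_compact C_horo nU.
(* The product equals g_(t-s) Phi_t(c). For t >= T the factor Phi_t(c) lies in K1, for smaller t in
   K2. *)
pose K1 : set G := [set (d * u1^-1)%g | d in D0].
pose K2 : set G := [set Phi x.1 x.2 | x in `[0, T] `*` C].
pose K : set G := [set (g x.1 * x.2)%g | x in `[-1, 1] `*` (K1 `|` K2)].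
exists K.
  apply: continuous_compact.
    apply: continuous_subspaceT => -[x y]; apply: cvgMg; last exact: cvg_snd.
    by apply: (cvg_comp (fun p : R * G => p.1) g _ (hg.1 x)); exact: cvg_fst.
  apply: compact_setX; first exact: segment_compact.
  apply: compactU; apply: continuous_compact => //.
  - by apply: continuous_subspaceT; exact: mulgr_continuous.
  - apply: continuous_subspaceT => -[x y].
    by apply: cvg_conj_flow => //; [exact: cvg_fst|exact: cvg_snd].
  - by apply: compact_setX => //; exact: segment_compact.
move=> s t c t0 ts Cc; exists (t - s, Phi t c).
  split; first by rewrite /= in_itv/= -ler_norml.
  have [Tt|tT] := lerP T t; last first.
    by right; exists (t, c) => //; split=> //=; rewrite in_itv/= t0 ltW.
  left; exists (Phi t c * u1)%g; last by rewrite mulgK.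
  apply: U0D; split; last exact: hT.
  by apply: horoM => //; apply: horo_conj_flow => //; exact: C_horo.
by rewrite /= /conj_flow !mulgA -hg.2 addrAC subrr add0r.
Qed.

Variables (Gamma : set G) (z : G).
Hypothesis hGamma : discrete_subgroup Gamma.

(** Comparing a return with a fixed one (d1, s1, w1, x1) eliminates y: w z (x x1^-1) = g_(-s) d
    d1^-1 g_s1 w1 z. So x x1^-1 lies in a finite set that depends neither on y nor on the time
    interval. *)
Lemma returns_unit_time : exists N : nat, exists2 O, nbhs (1%g : G) O &
  forall y (i : nat), exists2 l : seq G, (size l <= N)%N &
    forall d (s : R) o x, D0 d -> i%:R <= s <= i.+1%:R -> O o -> Gamma x ->
      (g (- s) * d * y = o * z * x)%g -> x \in l.
Proof.
have [K cK hK] := backward_compact.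
have [W nW [S hS]] := discrete_near_finite z hGamma cK.
have [G1 GM GV] := proj1 hGamma.
exists (size S), W => // y i.
pose P x := exists d s o, [/\ D0 d, i%:R <= s <= i.+1%:R, W o, Gamma x &
      (g (- s) * d * y = o * z * x)%g].
have [ [x1 [d1 [s1 [w1 [Dd1 s1i Ow1 Gx1 e1]]]]]|nP] := pselect (exists x, P x);
    last first.
  exists [::] => // d s w x Dd si Ww Gx e; exfalso; apply: nP.
  by exists x, d, s, w.
exists [seq (x * x1)%g | x <- S]; first by rewrite size_map.
move=> d s w x Dd si Ww Gx e; apply/mapP; exists (x * x1^-1)%g; last first.
  by rewrite mulgVK.
apply: (hS w w1 (g (- s) * (d * d1^-1) * g s1)%g) => //.
- apply: hK.
  + by move: s1i => /andP[+ _]; apply: le_trans.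
  + move: si s1i => /andP[a1 a2] /andP[b1 b2].
    by rewrite ler_norml; move: a2 b2; rewrite -!natr1 => a2 b2; lra.
  + by exists (d, d1).
- by apply: GM => //; exact: GV.
- rewrite -(mulgA _ (g s1)) -(mulgA _ _ z).
  have -> : (g s1 * w1 * z = d1 * y * x1^-1)%g.
    have -> : (g s1 * w1 * z = g s1 * (w1 * z * x1) * x1^-1)%g.
      by rewrite !mulgA mulgK.
    by rewrite -e1 !mulgA -hg.2 subrr (one_parameter0 hg) mul1g.
  by rewrite mulgA -e !mulgA mulgVK.
Qed.

(** Two returns with the same x satisfy g_(-s) d q^-1 g_s1 = w w1^-1, which is near 1, so d q^-1 is
    in V by transversality. It matters that N comes before M and V: the length of a block is chosen
    from N, and V from that length. *)
Lemma returns_patches : exists N : nat, forall (M : nat) V,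
  nbhs (1%g : G) V -> exists2 O, nbhs (1%g : G) O &
  forall y, exists2 l : seq G, (size l <= M.+1 * N)%N &
    forall d (s : R) o x, D0 d -> 0 <= s <= M%:R -> O o -> Gamma x ->
      (g (- s) * d * y = o * z * x)%g -> exists2 q, q \in l & V (d * q^-1)%g.
Proof.
have [N [W0 nO0 hN]] := returns_unit_time.
exists N => M V nV.
have [W1 nO1 hO1] := horo_transverse_near hG hg M%:R C_compact C_horo nV.
have [W2 nO2 O21] := nbhs1_smallV nO1.
exists (W0 `&` W2); first exact: filterI.
move=> y.
pose L i := projT1 (cid2 (hN y i)).
have sL i : (size (L i) <= N)%N by rewrite /L; case: cid2.
have hL i : forall d (s : R) o x, D0 d -> i%:R <= s <= i.+1%:R -> W0 o -> Gamma x ->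
      (g (- s) * d * y = o * z * x)%g -> x \in L i.
  by rewrite /L; case: cid2.
pose P x d := exists s o, [/\ D0 d, 0 <= s <= M%:R, (W0 `&` W2) o, Gamma x &
  (g (- s) * d * y = o * z * x)%g].
(* One representative q for each x that occurs; the default 1 stands for those x that do not. There
   are M + 1 unit intervals, as s = M is put into the one starting at M. *)
exists [seq xget 1%g (P x) | x <- flatten [seq L i | i <- iota 0 M.+1]].
  rewrite size_map size_flatten /shape -map_comp.
  rewrite -[M.+1 in leqRHS](size_iota 0); elim: (iota _ _) => //= i r IH.
  by rewrite mulSn leq_add.
move=> d s w x Dd sM Ww Gx e.
have Px : P x d by exists s, w.
have [s1 [w1 [Dq s1M Ow1 _ e1]]] := xgetPex 1%g (ex_intro _ d Px).
exists (xget 1%g (P x)).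
  apply: map_f; apply/flattenP; exists (L (Num.truncn s)).
    apply: map_f; rewrite mem_iota /= add0n ltnS.
    by rewrite truncn_le_nat; case/andP: sM => ? sM; apply: le_lt_trans sM _;
       rewrite ltr_nat.
  apply: (hL _ d s w) => //; last by case: Ww.
  by rewrite truncn_le ?(andP sM).1//= ltW// truncnS_gt.
apply: (hO1 s s1) => //; first by exists (d, xget 1%g (P x)).
have -> : (g (- s) * (d * (xget 1%g (P x))^-1) * g s1 = w * w1^-1)%g.
  have -> : (g s1 = (xget 1%g (P x) * y * x^-1 * z^-1 * w1^-1))%g.
    by rewrite -!mulgA -!invgM !mulgA -e1 !invgM -(one_parameterN hg) opprK -!mulgA
      (mulgA y) mulgV mul1g mulVKg.
  by rewrite !mulgA mulgVK e mulgK mulgK.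
by apply: O21; [case: Ww|case: Ow1].
Qed.

End Patches.

(** * Modified Schmidt games *)

Lemma compact_nested (T : topologicalType) (A : nat -> set T) :
  hausdorff_space T -> (forall k, compact (A k)) -> (forall k, A k !=set0) ->
  (forall k, A k.+1 `<=` A k) -> exists p, forall k, A k p.
Proof.
move=> hT cA nA AS.
have Ale m p : A (m + p)%N `<=` A m.
  elim: p => [|p IH]; first by rewrite addn0.
  by rewrite addnS; exact: subset_trans IH.
pose F := filter_from [set: nat] A.
have FF : ProperFilter F.
  apply: filter_from_proper; last by move=> m _; exact: nA.
  apply: filter_from_filter; first by exists 0%N.
  move=> i j _ _; exists (i + j)%N => // u Au; split; first exact: Ale Au.
  by move: Au; rewrite addnC; exact: Ale.
have [p [_ cp]] : A 0%N `&` cluster F !=set0 by apply: cA; exists 0%N.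
exists p => k; have := compact_closed hT (cA k); apply=> B nB.
by apply: cp => //; exists k.
Qed.

(** Provides the length m of a block: there are fewer than 2 ^ m patches in the time window attached
    to it. With m = 2 K the power is the square of 2 ^ K > K. *)
Lemma expn2_gt_linear (P Q N : nat) :
  exists2 m, (0 < m)%N & ((m * P + Q).+1 * N < 2 ^ m)%N.
Proof.
pose K := ((2 * P + Q.+1) * N).+1; exists (2 * K)%N => //.
have -> : (2 ^ (2 * K) = 2 ^ K * 2 ^ K)%N by rewrite mul2n -addnn expnD.
have K2 : (K < 2 ^ K)%N by apply: ltn_expl.
apply: (@leq_ltn_trans (K * K)); last by rewrite ltn_mul.
apply: (@leq_trans (K * ((2 * P + Q.+1) * N))); last first.
  by rewrite leq_mul2l leqnSn orbT.
rewrite mulnA leq_mul2r -addnS mulnDr mulnA [(K * 2)%N]mulnC leq_add2l.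
by rewrite leq_pmull ?orbT.
Qed.

Lemma nat_bracket (R : realType) (d t : R) : 0 < d -> 0 < t ->
  exists j : nat, j%:R * d < t <= j.+1%:R * d.
Proof.
move=> d0 t0; have ex : exists j : nat, t <= j%:R * d.
  exists (Num.truncn (t / d)).+1.
  by rewrite -ler_pdivrMr// ltW// truncnS_gt.
have [] := ex_minnP ex; case=> [|j] tj jmin.
  by move: tj; rewrite mul0r leNgt t0.
exists j; rewrite tj andbT ltNge; apply/negP => /jmin.
by rewrite ltnn.
Qed.

Section Game.
Variables (R : realType) (G : topologicalGroupType) (g : R -> G).
Hypotheses (hG : hausdorff_space G) (hg : one_parameter_subgroup g).
Local Notation Phi := (conj_flow g).
Local Notation H := (expanding_horospherical g).
Variable D0 : set G.
Hypothesis hD0 : admissible H D0.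

Definition translate_domain t h : set G := [set (Phi t d * h)%g | d in D0].

(** A strategy sees the moves of Bob as bare sets, so the shift has to be recovered by choice; 1 is
    a default for sets that are not domains. *)
Definition domain_shift t (B : set G) : G :=
  xget 1%g [set h | H h /\ B = translate_domain t h].

Lemma domain_shiftP t B : msg_domains H Phi D0 t B ->
  H (domain_shift t B) /\ B = translate_domain t (domain_shift t B).
Proof.
move=> [h Hh hB]; rewrite /domain_shift.
by apply: (@xgetPex _ 1%g [set h | H h /\ B = translate_domain t h]); exists h.
Qed.

Lemma translate_domain_compact t h : compact (translate_domain t h).
Proof.
have [_ D0c _] := hD0; apply: continuous_compact => //.
apply: continuous_subspaceT => x; apply: cvgMg; last exact: cvg_cst.
exact: conj_flow_continuous.
Qed.

(* [B] meets the patch [V q], rescaled to the domain [translate_domain t0 h0]. *)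
Definition meets (t0 : R) (h0 : G) (V : set G) (B : set G) : pred G :=
  fun q => `[< exists2 p, B p & V (Phi (- t0) (p * h0^-1) * q^-1)%g >].

Lemma meets_sub t0 h0 V (A B : set G) q :
  A `<=` B -> meets t0 h0 V A q -> meets t0 h0 V B q.
Proof. by move=> AB /asboolP[p Ap Vp]; apply/asboolP; exists p => //; exact: AB. Qed.

Variables (V0 : set G) (a : R) (c1 c2 : G).
Hypotheses (Hc1 : H c1) (Hc2 : H c2).
Hypothesis hc : forall d, D0 d ->
  D0 (Phi a d * c1)%g /\ D0 (Phi a d * c2)%g.
Hypothesis hV0 : forall d1 d2 v1 v2, D0 d1 -> D0 d2 -> V0 v1 -> V0 v2 ->
  ((Phi a d1 * c1) * (Phi a d2 * c2)^-1 <> v1 * v2^-1)%g.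

(** The piece Phi_a(D0) c of D0, carried into the domain Phi_t(D0) h. *)
Definition option_domain t h c : set G := translate_domain (t + a) (Phi t c * h)%g.

Lemma option_domain_sub t h c : (forall d, D0 d -> D0 (Phi a d * c)%g) ->
  option_domain t h c `<=` translate_domain t h.
Proof.
move=> Dc _ [d Dd <-]; exists (Phi a d * c)%g; first exact: Dc.
by rewrite conj_flowM// conj_flowD// -mulgA.
Qed.

(** After rescaling by Phi_(t0-t), the factors depending on h, h0 and q are common to both meetings
    and cancel in the quotient, which is then excluded by [hV0]. *)
Lemma option_domain_meets t h t0 h0 V q :
  (forall v, V v -> V0 (Phi (t0 - t) v)) ->
  meets t0 h0 V (option_domain t h c1) q ->
  meets t0 h0 V (option_domain t h c2) q -> False.
Proof.
move=> VV0 /asboolP[_ [d1 Dd1 <-] /VV0 V1] /asboolP[_ [d2 Dd2 <-] /VV0 V2].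
apply: (hV0 Dd1 Dd2 V1 V2).
have e d c : (Phi t (Phi a d * c) * h = Phi (t + a) d * (Phi t c * h))%g.
  by rewrite conj_flowM// conj_flowD// -mulgA.
have f u : (Phi (t0 - t) (Phi (- t0) (Phi t u * h * h0^-1) * q^-1) =
    u * (Phi (t0 - t) (Phi (- t0) (h * h0^-1) * q^-1)))%g.
  rewrite -[(Phi t u * h * _)%g]mulgA [Phi (- t0) _]conj_flowM//.
  rewrite -[(_ * _ * q^-1)%g]mulgA [Phi (t0 - t) _]conj_flowM//; congr (_ * _)%g.
  by rewrite -!conj_flowD// [in LHS](_ : _ + _ = 0) ?conj_flow0//; ring.
by rewrite -!e !f mulgKA.
Qed.

Definition best_option t h t0 h0 V (l : seq G) : set G :=
  if (count (meets t0 h0 V (option_domain t h c1)) l <=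
      count (meets t0 h0 V (option_domain t h c2)) l)%N
  then option_domain t h c1 else option_domain t h c2.

Lemma best_optionP t h t0 h0 V l : exists2 c, H c & 
  (forall d, D0 d -> D0 (Phi a d * c)%g) /\
  best_option t h t0 h0 V l = option_domain t h c.
Proof.
rewrite /best_option; case: ifP => _; [exists c1|exists c2] => //.
  by split => // d /hc[].
by split => // d /hc[].
Qed.

(** No patch meets both options, and a patch that meets one of them meets the whole domain; so the
    two counts add up to at most the count for the domain. *)
Lemma best_option_count t h t0 h0 V l :
  (forall v, V v -> V0 (Phi (t0 - t) v)) ->
  (2 * count (meets t0 h0 V (best_option t h t0 h0 V l)) l <=
    count (meets t0 h0 V (translate_domain t h)) l)%N.
Proof.
move=> VV0; set A1 := option_domain t h c1; set A2 := option_domain t h c2.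
have : (count (meets t0 h0 V A1) l + count (meets t0 h0 V A2) l <=
    count (meets t0 h0 V (translate_domain t h)) l)%N.
  rewrite -count_predUI [X in (_ + X)%N](_ : _ = 0%N) ?addn0; last first.
    apply/eqP; rewrite -leqn0 leqNgt -has_count; apply/hasPn => q _ /=.
    by apply/negP => /andP[m1 m2]; exact: (option_domain_meets VV0 m1 m2).
  apply: sub_count => q /= /orP[]; apply: meets_sub; apply: option_domain_sub.
    by move=> d /hc[].
  by move=> d /hc[].
rewrite /best_option -/A1 -/A2 => le; apply: leq_trans le.
case: (leqP (count (meets t0 h0 V A1) l)) => [?|/ltnW ?];
  by rewrite mul2n -addnn ?leq_add2l ?leq_add2r.
Qed.

Variables (Gamma : set G) (x z : G).
Hypothesis hGamma : discrete_subgroup Gamma.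

(** Patches are measured at the scale of the start of the block. Seen from the later moves they are
    expanded by Phi at negative times, so V must be small enough for all m moves. *)
Lemma pull_back_nbhs (m : nat) (delta : R) : nbhs (1%g : G) V0 ->
  exists2 V, nbhs (1%g : G) V &
  forall i v, (i < m)%N -> V v -> V0 (Phi (- (i%:R * delta)) v).
Proof.
move=> nV0; elim: m => [|m [V nV hV]]; first by exists V0.
exists (V `&` [set v | V0 (Phi (- (m%:R * delta)) v)]).
  apply: filterI => //; have := @conj_flow_continuous _ _ _ hg (- (m%:R * delta)) 1%g.
  by rewrite /continuous_at conj_flow1//; apply.
move=> i v; rewrite ltnS leq_eqVlt => /orP[/eqP-> [] //|im [Vv _]].
exact: hV.
Qed.

Theorem avoid_point_strategy (b t1 : R) : nbhs (1%g : G) V0 -> 0 < a + b ->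
  exists sigma : seq (set G) -> set G, forall B : nat -> set G,
    let A k := sigma (mkseq B k.+1) in
    (forall k, msg_domains H Phi D0 (msg_time a b t1 k) (B k) ->
       alice_legal H Phi D0 a b t1 A B k) /\
    ((forall k, bob_legal H Phi D0 a b t1 A B k) ->
      exists2 p, \bigcap_k A k = [set p] &
        H p /\ exists2 W, nbhs (1%g : G) W &
          forall t w y, 0 <= t -> W w -> Gamma y ->
            (g t * p * x <> w * z * y)%g).
Proof.
move=> nV0 ab0.
(* The order of the choices: N from the lattice, the length m from N, the size V of the patches from
   m, and finally W from m and V. P and Q bound a + b and |t1|, so m P + Q bounds the time window of
   a block. *)
have [N hN] := returns_patches hG hg hD0 z hGamma.
pose P := (Num.truncn (a + b)).+1; pose Q := (Num.truncn `|t1|).+1.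
have [m m0 mN] := expn2_gt_linear P Q N.
have [V nV hV] := pull_back_nbhs m (a + b) nV0.
have [W nW hW] := hN (m * P + Q)%N V nV.
pose time := msg_time a b t1.
pose patches y := projT1 (cid2 (hW y)).
have patchesP y : (size (patches y) < 2 ^ m)%N /\
   forall d (s : R) o x, D0 d -> 0 <= s <= (m * P + Q)%:R -> W o -> Gamma x ->
      (g (- s) * d * y = o * z * x)%g -> exists2 q, q \in patches y & V (d * q^-1)%g.
  rewrite /patches; case: cid2 => l /= sl hl; split => //.
  exact: leq_ltn_trans mN.
pose start k := (k %/ m * m)%N.
pose move_at k (B0 B : set G) :=
  let h0 := domain_shift (time (start k)) B0 in
  best_option (time k) (domain_shift (time k) B) (time (start k)) h0 V
    (patches (g (time (start k)) * h0 * x)%g).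
(* At stage k the list holds the moves 0 to k, whence the predecessor of its size. The move that
   opened the block is read off again, because the patches refer to it. *)
exists (fun Bs => move_at (size Bs).-1 (nth set0 Bs (start (size Bs).-1))
  (nth set0 Bs (size Bs).-1)) => B A.
have startle k : (start k <= k)%N by exact: leq_divM.
have AE k : A k = move_at k (B (start k)) (B k).
  by rewrite /A size_mkseq /= !nth_mkseq//= ltnS.
clearbody A.
pose h k := domain_shift (time k) (B k).
have A_option k : exists2 c, H c & (forall d, D0 d -> D0 (Phi a d * c)%g) /\
    A k = option_domain (time k) (h k) c.
  by rewrite AE; exact: best_optionP.
have legal k : msg_domains H Phi D0 (time k) (B k) ->
    alice_legal H Phi D0 a b t1 A B k.
  move=> /domain_shiftP[Hh eB]; have [c Hc [Dc eA]] := A_option k.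
  split; last by rewrite eA eB; exact: option_domain_sub.
  rewrite eA; exists (Phi (time k) c * h k)%g => //.
  by apply: horoM => //; exact: horo_conj_flow.
split => // bl.
have hP k : H (h k) /\ B k = translate_domain (time k) (h k).
  by apply: domain_shiftP; have [] := bl k.
have AB k : A k `<=` B k by have [] := legal _ (proj1 (bl k)).
have BA k : B k.+1 `<=` A k by have [] := bl k.+1.
have timeD k i : time (k + i)%N = time k + i%:R * (a + b).
  by rewrite /time /msg_time natrD mulrDl addrA.
pose cnt k (C : set G) := count (meets (time (start k)) (h (start k)) V C)
  (patches (g (time (start k)) * h (start k) * x)%g).
have halve k : (2 * cnt k (A k) <= cnt k (B k))%N.
  have shrink v : V v -> V0 (Phi (time (start k) - time k) v).
    rewrite {2}(divn_eq k m) -/(start k) timeD opprD addrA subrr add0r.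
    by apply: hV => //; rewrite ltn_mod.
  have := best_option_count (h k) (h (start k))
    (patches (g (time (start k)) * h (start k) * x)%g) shrink.
  by rewrite -(proj2 (hP k)) /cnt AE.
have startM j i : (i < m)%N -> start (j * m + i) = (j * m)%N.
  by move=> im; rewrite /start divnMDl// divn_small// addn0.
have startM0 j : start (j * m)%N = (j * m)%N by rewrite /start mulnK.
(* Each move of Alice halves the number of patches that are met, and the reply of Bob cannot raise
   it. *)
have block_cnt j i : (i < m)%N ->
    (2 ^ i * cnt (j * m)%N (B (j * m + i)%N) < 2 ^ m)%N.
  elim: i => [_|i IH im].
    rewrite expn0 mul1n; apply: leq_ltn_trans (count_size _ _) _.
    by have [] := patchesP (g (time (start (j * m)%N)) * h (start (j * m)%N) * x)%g.
  apply: leq_ltn_trans (IH (ltnW im)); rewrite expnSr -mulnA leq_mul2l.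
  apply/orP; right.
  have cE C : cnt (j * m)%N C = cnt (j * m + i)%N C.
    by rewrite /cnt startM ?(ltnW im)// startM0.
  rewrite !cE; apply: leq_trans (halve _).
  rewrite leq_mul2l; apply: sub_count => q; apply: meets_sub.
  by rewrite addnS; exact: BA.
have block_end j : cnt (j * m)%N (A (j * m + m.-1)%N) = 0%N.
  have im : (m.-1 < m)%N by rewrite prednK.
  have cE C : cnt (j * m)%N C = cnt (j * m + m.-1)%N C.
    by rewrite /cnt startM// startM0.
  (* The last move of the block halves once more, so 2 ^ m times the count is below 2 ^ m. *)
  apply/eqP; rewrite -leqn0 -ltnS -(ltn_pmul2l (m := 2 ^ m)) ?expn_gt0// muln1.
  apply: leq_ltn_trans (block_cnt j _ im).
  by rewrite -{1}(prednK m0) expnSr -mulnA leq_mul2l !cE halve orbT.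
have [p Ap] : exists p, forall k, A k p.
  apply: compact_nested => // k.
  - by have [c _ [_ ->]] := A_option k; exact: translate_domain_compact.
  - have [c _ [_ ->]] := A_option k; have [_ _ [U [_ [u Uu] UD]]] := hD0.
    by exists (Phi (time k + a) u * (Phi (time k) c * h k))%g; exists u => //; exact: UD.
  - by apply: subset_trans (BA k); exact: AB.
exists p.
  apply/seteqP; split => [q Aq|_ -> k _]; last exact: Ap.
  (* For a second point q, every k gives q p^-1 = Phi_(time k + a)(dq dp^-1) with dq, dp in D0.
     Since D0 D0^-1 is contracted uniformly, this eventually falls in a neighbourhood of 1 that
     omits q p^-1. *)
  apply: contrapT => /= qp.
  have /nbhs1_neq : (q * p^-1)%g <> 1%g by move=> /divg1_eq.
  move=> /(_ hG) nqp.
  have [D0H D0c _] := hD0.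
  have cC : compact [set (y.1 * y.2^-1)%g | y in D0 `*` D0].
    apply: continuous_compact; last exact: compact_setX.
    apply: continuous_subspaceT => -[u v]; apply: cvgMg; first exact: cvg_fst.
    by apply: cvgVg; exact: cvg_snd.
  have CH : [set (y.1 * y.2^-1)%g | y in D0 `*` D0] `<=` H.
    move=> _ [[u v] [/= Du Dv] <-].
    by apply: horoM => //; [exact: D0H|apply: horoV => //; exact: D0H].
  have [T hT] := horo_contract_compact hg hD0 cC CH nqp.
  pose k := (Num.truncn (`|T - t1 - a| / (a + b))).+1.
  have Tk : T <= time k + a.
    have : `|T - t1 - a| <= k%:R * (a + b).
      by rewrite -ler_pdivrMr// ltW// truncnS_gt.
    move=> /(le_trans (ler_norm _)); rewrite /time /msg_time; lra.
  have [c Hc [Dc eA]] := A_option k.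
  have := Ap k; have := Aq k I; rewrite eA => -[dq Dq eq] [dp Dp ep].
  apply: (hT _ (dq * dp^-1)%g Tk); first by exists (dq, dp).
  by rewrite -eq -ep mulgKA conj_flowM// conj_flowV.
split.
  have [c Hc [Dc eA]] := A_option 0%N; have := Ap 0%N; rewrite eA => -[d Dd <-].
  have [D0H _ _] := hD0.
  apply: horoM => //; first by apply: horo_conj_flow => //; exact: D0H.
  by apply: horoM => //; [exact: horo_conj_flow|have [] := hP 0%N].
exists W => // t w y t0 Ww Gy e.
have mP : m%:R * (a + b) <= (m * P)%:R.
  by rewrite natrM ler_wpM2l// ltW// truncnS_gt.
have t1Q : `|t1| <= Q%:R by rewrite ltW// truncnS_gt.
have mab : 0 < m%:R * (a + b) by rewrite mulr_gt0// ltr0n.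
(* The first block starting at time t or later takes care of time t. If t <= t1 this is block 0, and
   the delay is at most |t1|; otherwise it is less than the duration of one block. *)
have [j sj] : exists j, 0 <= time (j * m)%N - t <= (m * P + Q)%:R.
  rewrite natrD /time /msg_time; have [tt1|t1t] := lerP t t1.
    exists 0%N; rewrite mul0n mul0r addr0 subr_ge0 tt1/=.
    have := ler_norm t1; lra.
  have [||j /andP[j1 j2]] := @nat_bracket _ (m%:R * (a + b)) (t - t1) => //.
    by rewrite subr_gt0.
  exists j.+1; rewrite natrM -mulrA; apply/andP; split; first by lra.
  move: j1; rewrite -natr1 mulrDl mul1r => j1; have := normr_ge0 t1; lra.
have := AB _ _ (Ap (j * m)%N).
rewrite (proj2 (hP (j * m)%N)) => -[d Dd ep].
(* With p = Phi_time(d) h and s = time - t, the point g_t p x is g_(-s) d (g_time h x). A return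
   would therefore put d into a patch listed for this block, but p lies in the last move of the
   block, which meets none of them. *)
have [_ hq] := patchesP (g (time (j * m)%N) * h (j * m)%N * x)%g.
have [|q ql Vq] := hq d (time (j * m)%N - t) w y Dd sj Ww Gy.
  rewrite -e -ep /conj_flow !mulgA opprB hg.2.
  by rewrite (one_parameterN hg).
have /negP[] : ~~ has (meets (time (start (j * m)%N)) (h (start (j * m)%N)) V
   (A (j * m + m.-1)%N))
   (patches (g (time (start (j * m)%N)) * h (start (j * m)%N) * x)%g).
  by rewrite has_count -leqNgt leqn0; apply/eqP; exact: block_end.
rewrite startM0; apply/hasP; exists q => //; apply/asboolP; exists p => //.
by rewrite -ep mulgK conj_flowK.
Qed.

End Game.

(** * From equations in G to orbits in the coset space *)

Section Coset.
Local Open Scope quotient_scope.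
Variables (R : realType) (G : topologicalGroupType) (Gamma : set G) (g : R -> G).
Hypothesis hGamma : is_subgroup Gamma.

Lemma coset_piP (u v : G) :
  \pi_(coset_space Gamma) u = \pi_(coset_space Gamma) v <->
  exists2 y, Gamma y & v = (u * y)%g.
Proof.
have [G1 GM GV] := hGamma; split.
  move=> /eqmodP /asboolP e.
  have : left_coset Gamma v v by exists 1%g; rewrite ?mulg1.
  by rewrite -e => -[y Gy <-]; exists y.
move=> [y Gy ->]; apply/eqmodP/asboolP; apply/seteqP; split=> w [c Gc <-].
  by exists (y^-1 * c)%g; [apply: GM => //; exact: GV|rewrite mulgA mulgK].
by exists (y * c)%g; [exact: GM|rewrite mulgA].
Qed.

(** The image of W' z is a neighbourhood of the coset z, since W' is open and left translations act
    on cosets. An orbit point in it lifts to an equation in G that the hypothesis excludes. *)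
Lemma escapingP (x z : coset_space Gamma) (h : G) :
  (exists2 W, nbhs (1%g : G) W & forall t w y, 0 <= t -> W w -> Gamma y ->
     (g t * h * repr x <> w * repr z * y)%g) ->
  escaping g z (coset_translate h x).
Proof.
move=> [W nW hW]; have [G1 GM GV] := hGamma.
have [W' [W'o W'1] W'W] : exists2 B, open_nbhs (1%g : G) B & B `<=` W.
  by move: nW; rewrite nbhsE.
pose N : set (coset_space Gamma) :=
  [set \pi_(coset_space Gamma) (w * repr z)%g | w in W'].
have nN : nbhs z N.
  apply: open_nbhs_nbhs; split; last by exists 1%g; rewrite // mul1g reprK.
  rewrite /open/= /quotient_open openE => u [w W'w /coset_piP[y Gy e]].
  apply/nbhs_translate1.
  have : nbhs (1%g : G) [set s | W' (s * w)%g].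
    by apply: (proj1 (nbhs_translate1 _ _)); exact: open_nbhs_nbhs.
  apply: filterS => s /= W's; exists (s * w)%g => //; apply/coset_piP.
  by exists y => //; rewrite e !mulgA.
move=> /(_ _ nN)[_ [[t /= t0 <-] [w W'w]]].
rewrite /coset_translate => /coset_piP[y Gy].
(* The representative of the coset of h * repr x may differ from h * repr x by some y' in Gamma,
   which is absorbed into y. *)
have /coset_piP[y' Gy' ->] : \pi_(coset_space Gamma) (h * repr x)%g =
    \pi_(coset_space Gamma) (repr (\pi_(coset_space Gamma) (h * repr x)%g)).
  by rewrite reprK.
move=> e; apply: (hW t w (y * y'^-1)%g t0 (W'W _ W'w)); first exact/GM/GV.
by rewrite !mulgA -e !mulgA mulgK.
Qed.

End Coset.

Theorem escaping_a_winning (R : realType) (G : topologicalGroupType)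
    (Gamma : set G) (g : R -> G) (D0 : set G) (astar : R) :
  hausdorff_space G -> one_parameter_subgroup g -> discrete_subgroup Gamma ->
  admissible (expanding_horospherical g) D0 ->
  (exists2 h, expanding_horospherical g h & h <> 1%g) ->
  exists2 a'' : R, 0 < a'' &
    forall (x z : coset_space Gamma) (a : R), a'' < a ->
      a_winning (expanding_horospherical g) (conj_flow g) D0 astar a
        [set h | expanding_horospherical g h /\ escaping g z (coset_translate h x)].
Proof.
move=> hG hg hGamma hD0 /(horo_two_pieces hG hg hD0)[V0 [a0 [nV0 hV0]]].
(* Above this value a exceeds both a0 and astar, and a + b > 0 for every b > astar, even when astar
   is negative. *)
exists (`|a0| + `|astar| + 1) => [|x z a].
  by have := normr_ge0 a0; have := normr_ge0 astar; lra.
have := ler_norm a0; have := ler_norm astar; have := ler_norm (- astar).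
have := normr_ge0 a0; have := normr_ge0 astar; rewrite normrN => *.
split=> [|b ab]; first by lra.
have [|c1 [c2 [Hc1 Hc2 hc sep]]] := hV0 a; first by lra.
have ab0 : 0 < a + b by lra.
have /choice[sigma hsigma] := fun t1 => avoid_point_strategy hG hg hD0
  Hc1 Hc2 hc sep (repr x) (repr z) hGamma t1 nV0 ab0.
exists sigma => t1 B A; have [l w] := hsigma t1 B; split.
  by move=> k bl; apply: l; have [] := bl k (leqnn k).
move=> /w[p Ap [Hp hW]]; exists p => //; split => //.
by apply: escapingP => //; exact: (proj1 hGamma).
Qed.

(** * Differential calculus in coordinates *)

Section MatrixNorm.
Variable R : realType.

Lemma mx_entry_le m n (M : 'M[R]_(m, n)) i j : `|M i j| <= `|M|.
Proof.
rewrite [leRHS]/Num.norm /= mx_normrE.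
by apply/bigmax_geP; right => /=; exists (i, j).
Qed.

Lemma mx_norm_le m n (M : 'M[R]_(m, n)) c : 0 <= c ->
  (forall i j, `|M i j| <= c) -> `|M| <= c.
Proof.
move=> c0 Mc; rewrite [leLHS]/Num.norm /= mx_normrE.
by apply/bigmax_leP; split => // -[i j] _; exact: Mc.
Qed.

Lemma mulmx_norm_le m n p (A : 'M[R]_(m, n)) (B : 'M[R]_(n, p)) :
  `|A *m B| <= n%:R * `|A| * `|B|.
Proof.
apply: mx_norm_le => [|i j]; first by rewrite !mulr_ge0.
rewrite mxE; apply: le_trans (ler_norm_sum _ _ _) _.
rewrite -mulrA mulr_natl -[X in _ *+ X](card_ord n) -sumr_const.
apply: ler_sum => k _.
by rewrite normrM ler_pM// mx_entry_le.
Qed.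

Lemma mulmxr_continuous m n p (B : 'M[R]_(n, p)) :
  continuous (mulmxr B : 'M[R]_(m, n) -> 'M[R]_(m, p)).
Proof.
move=> A; apply: (proj2 (@cvgrPdist_le _ _ _ (nbhs A) _ _ _)) => e e0.
have K0 : 0 < n%:R * `|B| + 1 by rewrite ltr_wpDl// mulr_ge0.
near=> C; rewrite /= -mulmxBl.
apply: le_trans (mulmx_norm_le _ _) _.
rewrite mulrAC; apply: (@le_trans _ _ ((n%:R * `|B| + 1) * `|A - C|)).
  by rewrite ler_wpM2r// lerDl.
rewrite -ler_pdivlMl//; near: C.
by apply: cvgr_dist_le; rewrite ?mulr_gt0 ?invr_gt0.
Unshelve. all: by end_near. Qed.

End MatrixNorm.

Section Differentiability.
Variables (R : realType) (V W : normedModType R).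

Lemma is_diff_eps (f : V -> W) x (l : {linear V -> W}) : continuous l ->
  (forall e, 0 < e -> \forall u \near x, `|f u - f x - l (u - x)| <= e * `|u - x|) ->
  is_diff x f l.
Proof.
move=> cl hf.
have h : f \o shift x = cst (f x) + (l : V -> W) +o_ 0 id.
  apply/eqaddoP => e e0.
  have := hf _ e0; rewrite (near_shift 0) subr0; apply: filterS => u.
  by rewrite /= !fctE /= addrK opprD addrA.
have dl : 'd f x = l :> (V -> W) by exact: diff_unique.
apply: DiffDef => //; apply/diff_locallyP; rewrite dl; split => //.
Qed.

Lemma differentiable_eps (f : V -> W) x : differentiable f x ->
  forall e, 0 < e ->
    \forall u \near x, `|f u - f x - 'd f x (u - x)| <= e * `|u - x|.
Proof.
move=> /diff_locally /eqaddoP h e /h; rewrite [X in X -> _](near_shift x) sub0r.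
by apply: filterS => u /=; rewrite !fctE /= subrK opprD addrA.
Qed.

Lemma differentiable_lipschitz_at (f : V -> W) x : differentiable f x ->
  exists2 M, 0 <= M & \forall u \near x, `|f u - f x| <= M * `|u - x|.
Proof.
move=> df; have [k k0 hk] := linear_lipschitz (diff_continuous df).
exists (1 + k); first by rewrite addr_ge0 // ltW.
have := differentiable_eps df ltr01; apply: filterS => u hu.
rewrite -[f u - f x](subrK ('d f x (u - x))) mulrDl.
by apply: le_trans (ler_normD _ _) _; apply: lerD.
Qed.

End Differentiability.

Section PartialDerivatives.
Variable R : realType.

Lemma derive_line m (f : 'rV[R]_m -> R) (w v : 'rV[R]_m) (t : R) :
  derivable f (t *: v + w) v ->
  is_derive t 1 (fun s : R => f (s *: v + w)) ('D_v f (t *: v + w)).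
Proof.
move=> df; pose F s := f (s *: v + w).
have e : (fun h : R => h^-1 *: ((F \o shift t) (h *: 1) - F t)) =
    (fun h : R => h^-1 *: ((f \o shift (t *: v + w)) (h *: v) - f (t *: v + w))).
  by apply/funext => h; rewrite /F /= [h%:A]mulr1 scalerDl addrA.
by apply: DeriveDef; rewrite /derivable /derive e.
Qed.

Lemma mvt_line m (f : 'rV[R]_m -> R) (w v : 'rV[R]_m) (h : R) :
  (forall t, `|t| <= `|h| -> derivable f (t *: v + w) v) ->
  exists2 c, `|c| <= `|h| & f (h *: v + w) - f w = h * 'D_v f (c *: v + w).
Proof.
move=> df; pose F t := f (t *: v + w).
have dF (t : R) : `|t| <= `|h| -> is_derive t (1 : R) F ('D_v f (t *: v + w)).
  by move=> /df; exact: derive_line.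
have F0 : F 0 = f w by rewrite /F scale0r add0r.
have [h0|h0] := leP 0 h.
  have b t : t \in `[0, h] -> `|t| <= `|h|.
    by rewrite in_itv/= => /andP[t0 th]; rewrite !ger0_norm.
  have [||c ch] := @MVT_segment _ F (fun t => 'D_v f (t *: v + w)) _ _ h0.
  - by move=> t th; apply: dF; apply: b; exact: subset_itv_oo_cc.
  - by apply: derivable_within_continuous => t /b /dF[].
  by rewrite F0 subr0 mulrC => e; exists c => //; exact: b.
have b t : t \in `[h, 0] -> `|t| <= `|h|.
  rewrite in_itv/= => /andP[t0 th]; rewrite !ler0_norm ?lerN2//.
  exact: ltW.
have [||c ch] := @MVT_segment _ F (fun t => 'D_v f (t *: v + w)) _ _ (ltW h0).
- by move=> t th; apply: dF; apply: b; exact: subset_itv_oo_cc.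
- by apply: derivable_within_continuous => t /b /dF[].
rewrite F0 sub0r mulrN mulrC => e; exists c; first exact: b.
by rewrite -[RHS]opprK -e opprB.
Qed.

(** Go from u0 to u changing one coordinate at a time and apply the mean value theorem to each step.
    For the sup norm the intermediate points stay in the ball of radius |u - u0|. *)
Lemma partial_derivatives_bound m (f : 'rV[R]_m -> R) (u0 u : 'rV[R]_m)
    (L : 'I_m -> R) (eta : R) : 0 <= eta ->
  (forall w, `|w - u0| <= `|u - u0| -> forall i, derivable f w (delta_mx 0 i) /\
     `|'D_(delta_mx 0 i) f w - L i| <= eta) ->
  `|f u - f u0 - \sum_i (u - u0) 0 i * L i| <= m%:R * (eta * `|u - u0|).
Proof.
move=> eta0 hf.
pose w k : 'rV[R]_m := \row_j (if (j < k)%N then u 0 j else u0 0 j).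
have wm : w m = u by apply/rowP => j; rewrite mxE ltn_ord.
have w0 : w 0%N = u0 by apply/rowP => j; rewrite mxE.
have wS (i : 'I_m) : w i.+1 = ((u - u0) 0 i) *: delta_mx 0 i + w i.
  apply/rowP => j; rewrite !mxE eqxx /= ltnS.
  have [->|ji] := eqVneq j i; first by rewrite leqnn ltnn mulr1 subrK.
  by rewrite mulr0 add0r leq_eqVlt (negbTE (ji : (j : nat) != i)).
have wb (i : 'I_m) c : `|c| <= `|(u - u0) 0 i| ->
    `|c *: delta_mx 0 i + w i - u0| <= `|u - u0|.
  move=> cb; apply: mx_norm_le => // a j; rewrite (ord1 a) !mxE eqxx /=.
  have [->|ji] := eqVneq j i.
    by rewrite ltnn mulr1 addrK; apply: le_trans cb _; exact: mx_entry_le.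
  rewrite mulr0 add0r; case: ifP => _; last by rewrite subrr normr0.
  by have := mx_entry_le (u - u0) 0 j; rewrite !mxE.
rewrite -{1}wm -{1}w0 -(@telescope_sumr _ 0%N m (fun k => f (w k)))// big_mkord.
rewrite -sumrB; apply: le_trans (ler_norm_sum _ _ _) _.
rewrite mulr_natl -[X in _ *+ X](card_ord m) -sumr_const.
apply: ler_sum => i _; rewrite wS.
have [t tb|c cb ->] := @mvt_line _ f (w i) (delta_mx 0 i) ((u - u0) 0 i).
  by have [] := hf _ (wb i t tb) i.
rewrite -mulrBr normrM mulrC ler_pM//; last exact: mx_entry_le.
by have [] := hf _ (wb i c cb) i.
Qed.

(** Built from partial derivatives, so that it can be used before differentiability is known. It
    acts on row vectors on the right. *)
Definition Dmx m p (f : 'rV[R]_m -> 'rV[R]_p) (u : 'rV[R]_m) : 'M[R]_(m, p) :=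
  \matrix_i 'D_(delta_mx 0 i) f u.

Lemma derivable_coord m p (f : 'rV[R]_m -> 'rV[R]_p) u v j :
  derivable f u v -> derivable (fun x => f x 0 j) u v /\
  'D_v (fun x => f x 0 j) u = ('D_v f u) 0 j.
Proof.
move=> df.
have c : (fun h : R => h^-1 *: (((fun x => f x 0 j) \o shift u) (h *: v) - f u 0 j))
    @ 0^' --> ('D_v f u) 0 j.
  have e : (fun h : R => h^-1 *: (((fun x => f x 0 j) \o shift u) (h *: v) - f u 0 j)) =
     (fun M : 'rV[R]_p => M 0 j) \o
       (fun h : R => h^-1 *: ((f \o shift u) (h *: v) - f u)).
    by apply/funext => h; rewrite /= !mxE.
  by rewrite e; apply: cvg_comp df (@coord_continuous _ _ _ _ _ _).
by split; [apply/cvg_ex; eexists; exact: c|exact: cvg_lim c].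
Qed.

Lemma Dmx_bound m p (f : 'rV[R]_m -> 'rV[R]_p) (u0 u : 'rV[R]_m)
    (L : 'M[R]_(m, p)) (eta : R) : 0 <= eta ->
  (forall w, `|w - u0| <= `|u - u0| -> forall i, derivable f w (delta_mx 0 i) /\
     `|'D_(delta_mx 0 i) f w - row i L| <= eta) ->
  `|f u - f u0 - (u - u0) *m L| <= m%:R * (eta * `|u - u0|).
Proof.
move=> eta0 hf; apply: mx_norm_le => [|a j]; first by rewrite !mulr_ge0.
have -> : (f u - f u0 - (u - u0) *m L) a j =
    f u 0 j - f u0 0 j - \sum_i (u - u0) 0 i * L i j.
  by rewrite (ord1 a) !mxE.
apply: (@partial_derivatives_bound _ (fun x => f x 0 j) _ _ (fun i => L i j)) => //.
move=> w wu i; have [df db] := hf w wu i.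
have [d ->] := derivable_coord j df; split => //.
by apply: le_trans db; have := mx_entry_le ('D_(delta_mx 0 i) f w - row i L) 0 j;
  rewrite !mxE.
Qed.

Lemma nbhs_closed_ball m (u0 : 'rV[R]_m) (P : set 'rV[R]_m) :
  (\forall u \near u0, P u) ->
  \forall u \near u0, forall w, `|w - u0| <= `|u - u0| -> P w.
Proof.
move=> /nbhs_ballP[e /= e0 eP]; apply/nbhs_ballP; exists e => //= u.
rewrite -ball_normE /= => ue w wu; apply: eP; rewrite -ball_normE /=.
by rewrite distrC; apply: le_lt_trans wu _; rewrite distrC.
Qed.

Lemma C1_differentiable m p (U : set 'rV[R]_m) (f : 'rV[R]_m -> 'rV[R]_p) u0 :
  nbhs u0 U -> Ck_on 1 U f -> is_diff u0 f (mulmxr (Dmx f u0)).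
Proof.
move=> nU [_ hf]; apply: is_diff_eps; first exact: mulmxr_continuous.
move=> e e0.
have U0 : U u0 by exact: nbhs_singleton.
have m0 : 0 < m%:R + 1 :> R by rewrite ltr_wpDl.
have e'0 : 0 < e / (m%:R + 1) by rewrite divr_gt0.
have : \forall w \near u0, U w /\
    forall i, `|'D_(delta_mx 0 i) f w - row i (Dmx f u0)| <= e / (m%:R + 1).
  near=> w; split; first by near: w.
  near: w; apply: filter_forall => i; rewrite rowK.
  have [_ [/= cf _]] := hf i.
  have := cf u0 U0 => /(@cvgrPdist_le _ _ _ (nbhs u0) _ _ _) /(_ _ e'0).
  by apply: filterS => w; rewrite distrC.
move=> /nbhs_closed_ball; apply: filterS => u hu.
apply: le_trans (Dmx_bound (ltW e'0) _) _; last first.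
  rewrite mulrA ler_wpM2r// mulrA [m%:R * e]mulrC -mulrA ler_piMr ?(ltW e0)//.
  by rewrite ltW// ltr_pdivrMr// mul1r ltrDl.
move=> w wu i; have [Uw hw] := hu w wu; split; last exact: hw.
by have [df _] := hf i; exact: df.
Unshelve. all: by end_near. Qed.

(** A quadratic error instead of a little o: this form passes to compositions, and the shadowing
    argument needs it. *)
Definition quad_approx m p (f : 'rV[R]_m -> 'rV[R]_p) (u0 : 'rV[R]_m)
    (L : 'M[R]_(m, p)) : Prop :=
  exists2 M, 0 <= M & \forall u \near u0,
    `|f u - f u0 - (u - u0) *m L| <= M * `|u - u0| ^+ 2.

(** The partial derivatives are C1, so they deviate from their value at u0 by at most a multiple of
    |w - u0|; this deviation serves as eta in [Dmx_bound]. *)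
Lemma C2_quad_approx m p (U : set 'rV[R]_m) (f : 'rV[R]_m -> 'rV[R]_p) u0 :
  nbhs u0 U -> Ck_on 2 U f -> quad_approx f u0 (Dmx f u0).
Proof.
move=> nU [_ hf].
have /choice[M hM] (i : 'I_m) : exists M, 0 <= M /\ \forall w \near u0,
    `|'D_(delta_mx 0 i) f w - 'D_(delta_mx 0 i) f u0| <= M * `|w - u0|.
  have [_ /(C1_differentiable nU) d] := hf i.
  by have [M M0 hM] := differentiable_lipschitz_at (@ex_diff _ _ _ _ _ _ _ d); exists M.
pose K := \sum_i M i.
have MK i : M i <= K.
  rewrite /K (bigD1 i)//= lerDl sumr_ge0// => k _; exact: (proj1 (hM k)).
have K0 : 0 <= K by rewrite sumr_ge0// => k _; exact: (proj1 (hM k)).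
exists (m%:R * K); first by rewrite mulr_ge0.
have : \forall w \near u0, U w /\
    forall i, `|'D_(delta_mx 0 i) f w - row i (Dmx f u0)| <= K * `|w - u0|.
  near=> w; split; first by near: w.
  near: w; apply: filter_forall => i; rewrite rowK.
  have [_] := hM i; apply: filterS => w /le_trans; apply.
  by rewrite ler_wpM2r.
move=> /nbhs_closed_ball; apply: filterS => u hu.
rewrite expr2 !mulrA -mulrA -[m%:R * K * _]mulrA mulrA.
rewrite -!mulrA [K * _]mulrA; apply: Dmx_bound; first by rewrite mulr_ge0.
move=> w wu i; have [Uw hw] := hu w wu; split; last first.
  by apply: le_trans (hw i) _; rewrite ler_wpM2l.
by have [df _] := hf i; exact: df.
Unshelve. all: by end_near. Qed.

Lemma quad_approx_diff m p (f : 'rV[R]_m -> 'rV[R]_p) u0 L :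
  quad_approx f u0 L -> is_diff u0 f (mulmxr L).
Proof.
move=> [M M0 hM]; apply: is_diff_eps; first exact: mulmxr_continuous.
move=> e e0; have M1 : 0 < M + 1 by rewrite ltr_wpDl.
near=> u.
have /le_trans : `|f u - f u0 - (u - u0) *m L| <= M * `|u - u0| ^+ 2 by near: u.
apply; rewrite expr2 mulrA ler_wpM2r//.
apply: (@le_trans _ _ ((M + 1) * `|u - u0|)).
  by rewrite ler_wpM2r// lerDl.
rewrite -ler_pdivlMl// mulrC distrC; near: u.
apply/nbhs_ballP; exists (e / (M + 1)); first by rewrite /= divr_gt0.
by move=> w; rewrite -ball_normE /= => /ltW.
Unshelve. all: by end_near. Qed.

Lemma quad_approx_jacobian m p (f : 'rV[R]_m -> 'rV[R]_p) u0 L :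
  quad_approx f u0 L -> 'J f u0 = L.
Proof.
move=> /quad_approx_diff d; apply/row_matrixP => i.
by rewrite !rowE /jacobian mul_rV_lin1 (@diff_val _ _ _ _ _ _ _ d).
Qed.

Lemma quad_approx_near m p (f h : 'rV[R]_m -> 'rV[R]_p) u0 L :
  (\forall u \near u0, f u = h u) -> quad_approx f u0 L -> quad_approx h u0 L.
Proof.
move=> fh [M M0 hM]; exists M => //.
have e0 : f u0 = h u0 by exact: (nbhs_singleton fh).
by apply: filterS2 fh hM => u fu; rewrite fu e0.
Qed.

Lemma quad_approx_affine m p (f : 'rV[R]_m -> 'rV[R]_p) u0 L :
  (forall u, f u - f u0 = (u - u0) *m L) -> quad_approx f u0 L.
Proof.
move=> fL; exists 0 => //; near=> u.
by rewrite fL subrr normr0 mul0r.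
Unshelve. all: by end_near. Qed.

Lemma quad_approx_comp m p q (f : 'rV[R]_m -> 'rV[R]_p)
    (h : 'rV[R]_p -> 'rV[R]_q) u0 L K :
  quad_approx f u0 L -> quad_approx h (f u0) K ->
  quad_approx (h \o f) u0 (L *m K).
Proof.
move=> hf [N N0 hN]; have [M M0 hM] := hf.
have df := quad_approx_diff hf.
have [A A0 hA] := differentiable_lipschitz_at (@ex_diff _ _ _ _ _ _ _ df).
have cf : f @ nbhs u0 --> nbhs (f u0).
  exact: (differentiable_continuous (@ex_diff _ _ _ _ _ _ _ df)).
exists (N * A ^+ 2 + p%:R * M * `|K|).
  by rewrite addr_ge0 ?mulr_ge0 ?exprn_ge0.
have hN' := cf _ hN.
near=> u.
have h1 : `|f u - f u0 - (u - u0) *m L| <= M * `|u - u0| ^+ 2 by near: u.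
have h2 : `|f u - f u0| <= A * `|u - u0| by near: u.
have h3 : `|h (f u) - h (f u0) - (f u - f u0) *m K| <= N * `|f u - f u0| ^+ 2.
  by near: u.
have -> : (h \o f) u - (h \o f) u0 - (u - u0) *m (L *m K) =
    (h (f u) - h (f u0) - (f u - f u0) *m K) +
    (f u - f u0 - (u - u0) *m L) *m K.
  by rewrite (mulmxBl (f u - f u0)) mulmxA addrA subrK.
apply: le_trans (ler_normD _ _) _; rewrite mulrDl; apply: lerD.
  apply: le_trans h3 _; rewrite -mulrA ler_wpM2l// -exprMn.
  by apply: lerXn2r => //; rewrite nnegrE ?mulr_ge0.
apply: le_trans (mulmx_norm_le _ _) _.
by rewrite -!mulrA ler_wpM2l// (mulrC `|K|) mulrA ler_wpM2r.
Unshelve. all: by end_near. Qed.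

End PartialDerivatives.

(** * The adjoint representation in the chart at 1 *)

Section MatrixValued.
Variables (R : realType) (V : normedModType R).

Lemma mx_differentiable m p (F : V -> 'M[R]_(m, p)) x :
  (forall i j, differentiable (fun u => F u i j) x) -> differentiable F x.
Proof.
move=> dF; have -> : F = \sum_(i < m) \sum_(j < p) (fun u => F u i j *: delta_mx i j).
  apply/funext => u; rewrite [LHS]matrix_sum_delta fct_sumE.
  by apply: eq_bigr => i _; rewrite fct_sumE.
by do 2![apply: differentiable_sum => ?]; exact: differentiableZl.
Qed.

Lemma mx_differentiable_entry m p (F : V -> 'M[R]_(m, p)) x i j :
  differentiable F x -> differentiable (fun u => F u i j) x.
Proof.
move=> dF; apply: (@differentiable_comp _ _ _ _ F (fun M => M i j)) => //.
exact: differentiable_coord.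
Qed.

Lemma mulmx_differentiable m n p (A : V -> 'M[R]_(m, n)) (B : V -> 'M[R]_(n, p)) x :
  differentiable A x -> differentiable B x ->
  differentiable (fun u => A u *m B u) x.
Proof.
move=> dA dB; apply: mx_differentiable => i j.
have -> : (fun u => (A u *m B u) i j) =
    \sum_(k < n) ((fun u => A u i k) * (fun u => B u k j)).
  by apply/funext => u; rewrite fct_sumE mxE.
apply: differentiable_sum => k.
by apply: differentiableM; exact: mx_differentiable_entry.
Qed.

Lemma near_is_diff (W : normedModType R) (f h : V -> W) x :
  (\forall u \near x, f u = h u) -> differentiable f x -> is_diff x h ('d f x).
Proof.
move=> fh df; apply: is_diff_eps; first exact: diff_continuous.
have e0 : f x = h x by exact: (nbhs_singleton fh).
move=> e /(differentiable_eps df) hf.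
by apply: filterS2 fh hf => u fu; rewrite fu e0.
Qed.

End MatrixValued.

Lemma Dmx_differentiable (R : realType) m p (U : set 'rV[R]_m)
    (f : 'rV[R]_m -> 'rV[R]_p) u0 :
  nbhs u0 U -> Ck_on 2 U f -> differentiable (Dmx f) u0.
Proof.
move=> nU [_ hf]; apply: mx_differentiable => i j.
have -> : (fun u => Dmx f u i j) = (fun u => ('D_(delta_mx 0 i) f u) 0 j).
  by apply/funext => u; rewrite mxE.
apply: mx_differentiable_entry; have [_ /(C1_differentiable nU) d] := hf i.
exact: (@ex_diff _ _ _ _ _ _ _ d).
Qed.

Lemma open_within_continuous (T U : topologicalType) (A : set T) (f : T -> U) x :
  open A -> {within A, continuous f} -> A x -> {for x, continuous f}.
Proof.
by move=> oA; rewrite continuous_open_subspace// => cf Ax; apply: cf; exact: mem_set.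
Qed.

Section Chart.
Variables (R : realType) (n : nat) (T : topologicalType) (c : chart R n T).

Lemma chart_img_map x : chart_dom c x -> chart_img c (chart_map c x).
Proof. by exists x. Qed.

Lemma chart_invK u : chart_img c u -> chart_map c (chart_inv c u) = u.
Proof. by move=> [x cx <-]; rewrite chart_mapK. Qed.

Lemma chart_inv_dom u : chart_img c u -> chart_dom c (chart_inv c u).
Proof. by move=> [x cx <-]; rewrite chart_mapK. Qed.

Lemma nbhs_chart_dom x : chart_dom c x -> nbhs x (chart_dom c).
Proof. by move=> cx; apply: open_nbhs_nbhs; split => //; exact: chart_dom_open. Qed.

Lemma nbhs_chart_img u : chart_img c u -> nbhs u (chart_img c).
Proof. by move=> cu; apply: open_nbhs_nbhs; split => //; exact: chart_img_open. Qed.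

Lemma cvg_chart_inv u : chart_img c u -> {for u, continuous (chart_inv c)}.
Proof.
apply: open_within_continuous; [exact: chart_img_open|exact: chart_inv_continuous].
Qed.

End Chart.

Section Adjoint.
Variables (R : realType) (n : nat) (G : topologicalGroupType) (L : lie_group R n G).
Local Notation c := (chart_at L).
Local Notation cm := (chart_map (chart_at L 1%g)).
Local Notation ci := (chart_inv (chart_at L 1%g)).
Local Notation u0 := (chart_map (chart_at L 1%g) 1%g).

Definition mul_chart (x y z : G) (w : 'rV[R]_(n + n)) : 'rV[R]_n :=
  chart_map (c z) (chart_inv (c x) (lsubmx w) * chart_inv (c y) (rsubmx w))%g.

Definition mul_chart_dom (x y z : G) : set 'rV[R]_(n + n) :=
  [set w | [/\ chart_img (c x) (lsubmx w), chart_img (c y) (rsubmx w)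
    & chart_dom (c z) (chart_inv (c x) (lsubmx w) * chart_inv (c y) (rsubmx w))%g]].

Lemma nbhs_mul_chart_dom x y z w : mul_chart_dom x y z w ->
  nbhs w (mul_chart_dom x y z).
Proof.
move=> [wx wy wz].
have cl : {for w, continuous (lsubmx : _ -> 'rV[R]_n)}.
  exact: (@continuous_lsubmx R 1 n n w).
have cr : {for w, continuous (rsubmx : _ -> 'rV[R]_n)}.
  exact: (@continuous_rsubmx R 1 n n w).
have cx : chart_inv (c x) (lsubmx v) @[v --> w] --> chart_inv (c x) (lsubmx w).
  exact: (cvg_comp lsubmx _ cl (cvg_chart_inv wx)).
have cy : chart_inv (c y) (rsubmx v) @[v --> w] --> chart_inv (c y) (rsubmx w).
  exact: (cvg_comp rsubmx _ cr (cvg_chart_inv wy)).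
have n1 : \forall v \near w, chart_img (c x) (lsubmx v).
  exact: (cl _ (nbhs_chart_img wx)).
have n2 : \forall v \near w, chart_img (c y) (rsubmx v).
  exact: (cr _ (nbhs_chart_img wy)).
have n3 : \forall v \near w, chart_dom (c z)
    (chart_inv (c x) (lsubmx v) * chart_inv (c y) (rsubmx v))%g.
  exact: (cvgMg cx cy (nbhs_chart_dom wz)).
by apply: filterS3 n1 n2 n3 => v.
Qed.

Lemma mul_chart_quad x y z w : mul_chart_dom x y z w ->
  quad_approx (mul_chart x y z) w (Dmx (mul_chart x y z) w).
Proof.
move=> /nbhs_mul_chart_dom nw; apply: C2_quad_approx nw _.
exact: (@lie_mul_smooth _ _ _ L x y z 2%N).
Qed.

Lemma row_mx_quadl (u : 'rV[R]_n) (w : 'rV[R]_n) :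
  quad_approx (fun v => row_mx v w) u (row_mx 1%:M 0 : 'M[R]_(n, n + n)).
Proof.
apply: quad_approx_affine => v.
by rewrite opp_row_mx add_row_mx subrr mul_mx_row mulmx1 mulmx0.
Qed.

Lemma row_mx_quadr (u : 'rV[R]_n) (w : 'rV[R]_n) :
  quad_approx (fun v => row_mx w v) u (row_mx 0 1%:M : 'M[R]_(n, n + n)).
Proof.
apply: quad_approx_affine => v.
by rewrite opp_row_mx add_row_mx subrr mul_mx_row mulmx1 mulmx0.
Qed.

Definition conj_chart (x : G) (u : 'rV[R]_n) : 'rV[R]_n :=
  cm (x * ci u * x^-1)%g.

Lemma dom1 : chart_dom (c 1%g) 1%g. Proof. exact: chart_at_dom. Qed.

Lemma img_u0 : chart_img (c 1%g) u0. Proof. exact/chart_img_map/dom1. Qed.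

Lemma ci_u0 : ci u0 = 1%g. Proof. exact/chart_mapK/dom1. Qed.

Lemma cvg_ci : ci u @[u --> u0] --> (1%g : G).
Proof.
have : ci u @[u --> u0] --> ci u0 by exact: (cvg_chart_inv img_u0).
by rewrite ci_u0.
Qed.

Lemma conj_chart_u0 x : conj_chart x u0 = u0.
Proof. by rewrite /conj_chart ci_u0 mulg1 mulgV. Qed.

(** Conjugation is right multiplication by x^-1, from the chart at 1 to the chart at x^-1, followed
    by left multiplication by x. Each is a partial map of the multiplication in charts. *)
Lemma conj_chart_ex x : exists A, quad_approx (conj_chart x) u0 A.
Proof.
pose y := (x^-1)%g.
pose f u := mul_chart 1%g y y (row_mx u (chart_map (c y) y)).
pose h v := mul_chart x y 1%g (row_mx (chart_map (c x) x) v).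
have yd := chart_at_dom L y; have xd := chart_at_dom L x.
have fE u : f u = chart_map (c y) (ci u * y)%g.
  by rewrite /f /mul_chart row_mxKl row_mxKr (chart_mapK yd).
have hE v : h v = cm (x * chart_inv (c y) v)%g.
  by rewrite /h /mul_chart row_mxKl row_mxKr (chart_mapK xd).
have fu0 : f u0 = chart_map (c y) y by rewrite fE ci_u0 mul1g.
have qf := quad_approx_comp (row_mx_quadl u0 (chart_map (c y) y))
  (@mul_chart_quad 1%g y y (row_mx u0 (chart_map (c y) y)) _).
have qh := quad_approx_comp (row_mx_quadr (f u0) (chart_map (c x) x))
  (@mul_chart_quad x y 1%g (row_mx (chart_map (c x) x) (f u0)) _).
have {}qf := qf _; have {}qh := qh _.
eexists; apply: quad_approx_near (quad_approx_comp (qf _) (qh _)).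
- have : \forall u \near u0, chart_dom (c y) (ci u * y)%g.
    have cy : (ci u * y)%g @[u --> u0] --> (1 * y)%g.
      exact: (cvgMg cvg_ci (cvg_cst y)).
    by apply: cy; rewrite mul1g; exact: nbhs_chart_dom.
  apply: filterS => u ud.
  by rewrite /= -/(f u) -/(h (f u)) hE fE chart_mapK// mulgA.
- split; rewrite ?row_mxKl ?row_mxKr; [exact: img_u0|exact: chart_img_map|].
  by rewrite ci_u0 mul1g chart_mapK.
- split; rewrite ?row_mxKl ?row_mxKr; first exact: chart_img_map.
    by rewrite fu0; exact: chart_img_map.
  by rewrite fu0 !chart_mapK// mulgV; exact: dom1.
Qed.

Lemma conj_chart_quad x : quad_approx (conj_chart x) u0 (Ad L x).
Proof.
by have [A qA] := conj_chart_ex x; rewrite [Ad L x](quad_approx_jacobian qA).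
Qed.

Lemma Ad_quad x A : quad_approx (conj_chart x) u0 A -> Ad L x = A.
Proof. exact: quad_approx_jacobian. Qed.

Lemma near_conj_dom x : \forall u \near u0, chart_dom (c 1%g) (x * ci u * x^-1)%g.
Proof.
have cx : (x * ci u * x^-1)%g @[u --> u0] --> (x * 1 * x^-1)%g.
  exact: (cvgMg (cvgMg (cvg_cst x) cvg_ci) (cvg_cst _)).
by apply: cx; rewrite mulg1 mulgV; apply: nbhs_chart_dom; exact: dom1.
Qed.

Lemma conj_chartM x y : \forall u \near u0,
  conj_chart x (conj_chart y u) = conj_chart (x * y)%g u.
Proof.
have := near_conj_dom y; apply: filterS => u ud.
by rewrite /conj_chart chart_mapK// invgM !mulgA.
Qed.

(* [Ad] is an antihomomorphism since matrices act on row vectors. *)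
Lemma AdM x y : Ad L (x * y)%g = Ad L y *m Ad L x.
Proof.
apply: Ad_quad; apply: quad_approx_near (conj_chartM x y) _.
apply: quad_approx_comp; first exact: conj_chart_quad.
by rewrite conj_chart_u0; exact: conj_chart_quad.
Qed.

Lemma Ad1 : Ad L 1%g = 1%:M.
Proof.
apply: Ad_quad; apply: (@quad_approx_near _ _ _ id).
  have := nbhs_chart_img img_u0; apply: filterS => u uc.
  by rewrite /conj_chart invg1 mulg1 mul1g chart_invK.
by apply: quad_approx_affine => u; rewrite mulmx1.
Qed.

Lemma AdV x : Ad L x *m Ad L x^-1%g = 1%:M.
Proof. by rewrite -AdM mulVg Ad1. Qed.

Lemma AdVr x : Ad L x^-1%g *m Ad L x = 1%:M.
Proof. by rewrite -AdM mulgV Ad1. Qed.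

Definition inv_chart (u : 'rV[R]_n) : 'rV[R]_n := cm ((ci u)^-1)%g.

Lemma inv_chart_differentiable : differentiable inv_chart u0.
Proof.
pose U := [set u | chart_img (c 1%g) u /\ chart_dom (c 1%g) ((ci u)^-1)%g].
have nU : nbhs u0 U.
  apply: filterI; first exact/nbhs_chart_img/img_u0.
  have cV : (ci u)^-1%g @[u --> u0] --> (1^-1 : G)%g by exact: (cvgVg cvg_ci).
  by apply: cV; rewrite invg1; apply: nbhs_chart_dom; exact: dom1.
have d := C1_differentiable nU (@lie_inv_smooth _ _ _ L 1%g 1%g 1%N).
exact: (@ex_diff _ _ _ _ _ _ _ d).
Qed.

(** Conjugation by h = [ci u] is left multiplication by h followed by right multiplication by h^-1.
    This writes Ad h through first derivatives of the multiplication, which depend differentiably on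
    u. *)
Lemma Ad_ci : \forall u \near u0, Ad L (ci u) =
  (row_mx 0 1%:M *m Dmx (mul_chart 1%g 1%g 1%g) (row_mx u u0)) *m
  (row_mx 1%:M 0 *m Dmx (mul_chart 1%g 1%g 1%g) (row_mx u (inv_chart u))).
Proof.
have n1 : \forall u \near u0, chart_img (c 1%g) u by exact/nbhs_chart_img/img_u0.
have n2 : \forall u \near u0, chart_dom (c 1%g) (ci u)^-1%g.
  have cV : (ci u)^-1%g @[u --> u0] --> (1^-1 : G)%g by exact: (cvgVg cvg_ci).
  by apply: cV; rewrite invg1; apply: nbhs_chart_dom; exact: dom1.
apply: filterS2 n1 n2 => u ui ud; apply: Ad_quad.
pose f w := mul_chart 1%g 1%g 1%g (row_mx u w).
have fE w : f w = cm (ci u * ci w)%g by rewrite /f /mul_chart row_mxKl row_mxKr.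
have fu0 : f u0 = u by rewrite fE ci_u0 mulg1 chart_invK.
have qf : quad_approx f u0
    (row_mx 0 1%:M *m Dmx (mul_chart 1%g 1%g 1%g) (row_mx u u0)).
  apply: (quad_approx_comp (row_mx_quadr u0 u)); apply: mul_chart_quad.
  split; rewrite ?row_mxKl ?row_mxKr => //; first exact: img_u0.
  by rewrite ci_u0 mulg1; exact: chart_inv_dom.
have qh : quad_approx (fun v => mul_chart 1%g 1%g 1%g (row_mx v (inv_chart u))) (f u0)
    (row_mx 1%:M 0 *m Dmx (mul_chart 1%g 1%g 1%g) (row_mx u (inv_chart u))).
  rewrite fu0; apply: (quad_approx_comp (row_mx_quadl u (inv_chart u))).
  apply: mul_chart_quad.
  split; rewrite ?row_mxKl ?row_mxKr => //; first exact: chart_img_map.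
  by rewrite chart_mapK// mulgV; exact: dom1.
apply: quad_approx_near (quad_approx_comp qf qh).
have : \forall w \near u0, chart_dom (c 1%g) (ci u * ci w)%g.
  have cu : (ci u * ci w)%g @[w --> u0] --> (ci u * 1)%g.
    exact: (cvgMg (cvg_cst _) cvg_ci).
  by apply: cu; rewrite mulg1; apply: nbhs_chart_dom; exact: chart_inv_dom.
apply: filterS => w wd.
by rewrite /= fE /mul_chart row_mxKl row_mxKr /inv_chart !chart_mapK.
Qed.

Lemma Ad_ci_differentiable : differentiable (fun u => Ad L (ci u)) u0.
Proof.
pose m := mul_chart 1%g 1%g 1%g.
have dm w : mul_chart_dom 1%g 1%g 1%g w -> differentiable (Dmx m) w.
  move=> /nbhs_mul_chart_dom nw; apply: Dmx_differentiable nw _.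
  exact: (@lie_mul_smooth _ _ _ L 1%g 1%g 1%g 2%N).
have inv_u0 : inv_chart u0 = u0 by rewrite /inv_chart ci_u0 invg1.
have u00 : mul_chart_dom 1%g 1%g 1%g (row_mx u0 u0).
  split; rewrite ?row_mxKl ?row_mxKr; [exact: img_u0|exact: img_u0|].
  by rewrite !ci_u0 mulg1; exact: dom1.
have dr (f h : 'rV[R]_n -> 'rV[R]_n) : differentiable f u0 -> differentiable h u0 ->
    differentiable (fun u => row_mx (f u) (h u) : 'rV[R]_(n + n)) u0.
  move=> df dh; apply: mx_differentiable => i j; case: (split_ordP j) => k ->.
    under eq_fun do rewrite row_mxEl.
    exact: mx_differentiable_entry.
  under eq_fun do rewrite row_mxEr.
  exact: mx_differentiable_entry.
have key (M : 'M[R]_(n, n + n)) (h : 'rV[R]_n -> 'rV[R]_n) :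
    h u0 = u0 -> differentiable h u0 ->
    differentiable (fun u => M *m Dmx m (row_mx u (h u))) u0.
  move=> h0 dh; apply: mulmx_differentiable; first exact: differentiable_cst.
  apply: (@differentiable_comp _ _ _ _ (fun u => row_mx u (h u)) (Dmx m)).
    exact: dr.
  by rewrite h0; exact: dm.
have d : differentiable (fun u =>
  (row_mx 0 1%:M *m Dmx m (row_mx u u0)) *m
  (row_mx 1%:M 0 *m Dmx m (row_mx u (inv_chart u)))) u0.
  apply: mulmx_differentiable.
    exact: (key _ (cst u0)).
  by apply: key => //; exact: inv_chart_differentiable.
have e : \forall u \near u0, (row_mx 0 1%:M *m Dmx m (row_mx u u0)) *m
  (row_mx 1%:M 0 *m Dmx m (row_mx u (inv_chart u))) = Ad L (ci u).
  by have := Ad_ci; apply: filterS => u ->.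
exact: (@ex_diff _ _ _ _ _ _ _ (near_is_diff e d)).
Qed.

Local Notation dAd := ('d (fun u => Ad L (ci u)) u0).

Lemma lie_bracketE X Y : lie_bracket L X Y = Y *m dAd X.
Proof. by rewrite /lie_bracket deriveE//; exact: Ad_ci_differentiable. Qed.

(** Differentiate Ad(x h x^-1) = Ad(x^-1) Ad(h) Ad(x) in h at 1; the product is in this order
    because Ad reverses products. *)
Lemma lie_bracket_Ad x X Y :
  lie_bracket L (X *m Ad L x) (Y *m Ad L x) = lie_bracket L X Y *m Ad L x.
Proof.
set A := Ad L x; set B := Ad L x^-1%g.
pose conjA (M : 'M[R]_n) := B *m (M *m A).
have linA : linear conjA.
  by move=> k M N; rewrite /conjA mulmxDl -scalemxAl mulmxDr -scalemxAr.
pose lA : {linear 'M[R]_n -> 'M[R]_n} :=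
  HB.pack conjA (GRing.isLinear.Build _ _ _ _ _ linA).
have clA : continuous lA.
  move=> M; apply: differentiable_continuous.
  apply: (@mulmx_differentiable _ _ _ _ _ (fun=> B) (fun N => N *m A)).
    exact: differentiable_cst.
  apply: (@mulmx_differentiable _ _ _ _ _ id (fun=> A)).
    by [].
  exact: differentiable_cst.
have e1 : \forall u \near u0, lA (Ad L (ci u)) = Ad L (ci (conj_chart x u)).
  have := near_conj_dom x; apply: filterS => u ud.
  by rewrite /= /conjA /conj_chart chart_mapK// !AdM.
have dAdd := Ad_ci_differentiable.
have d1 : is_diff u0 (lA \o (fun u => Ad L (ci u))) (lA \o dAd).
  apply: is_diff_comp; first exact: differentiableP.
  by apply: DiffDef; [exact: linear_differentiable|exact: diff_lin].
have d2 : is_diff u0 ((fun u => Ad L (ci u)) \o conj_chart x) (dAd \o mulmxr A).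
  apply: is_diff_comp; first exact: quad_approx_diff (conj_chart_quad x).
  by rewrite conj_chart_u0; exact: differentiableP.
have d3 : is_diff u0 ((fun u => Ad L (ci u)) \o conj_chart x)
    ('d (lA \o (fun u => Ad L (ci u))) u0).
  exact: near_is_diff e1 (@ex_diff _ _ _ _ _ _ _ d1).
have v1 := @diff_val _ _ _ _ _ _ _ d1.
have v2 := @diff_val _ _ _ _ _ _ _ d2.
have v3 := @diff_val _ _ _ _ _ _ _ d3.
have e2 : dAd (X *m A) = B *m (dAd X *m A).
  have h2 := congr1 (fun f => f X) v2; have h1 := congr1 (fun f => f X) v1.
  exact: etrans (esym h2) (etrans (congr1 (fun f => f X) v3) h1).
have AB : A *m B = 1%:M by exact: AdV.
rewrite (lie_bracketE X Y) (lie_bracketE (X *m A) (Y *m A)) e2.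
by move: (dAd X) => D; rewrite -(mulmxA Y A) (mulmxA A B) AB mul1mx mulmxA.
Qed.

Lemma lie_bracket_bound : exists2 K, 0 <= K & forall X Y,
  `|lie_bracket L X Y| <= K * `|X| * `|Y|.
Proof.
have [k k0 hk] := linear_lipschitz (diff_continuous Ad_ci_differentiable).
exists (n%:R * k); first by rewrite mulr_ge0// ltW.
move=> X Y; rewrite lie_bracketE; apply: le_trans (mulmx_norm_le _ _) _.
by rewrite -!mulrA ler_wpM2l// mulrC [leRHS]mulrA ler_wpM2r.
Qed.

End Adjoint.

(** * Growth of matrix powers *)

Section SpectralGrowth.
Variable R : realType.
Local Notation C := (R[i]).
Local Notation modulus := (@Normc.normc R).
Local Notation toC := (real_complex R).

Lemma modulusE (z : C) : `|z| = toC (modulus z). Proof. by case: z. Qed.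

Lemma modulus_ge0 (z : C) : 0 <= modulus z.
Proof. by case: z => a b; rewrite /= sqrtr_ge0. Qed.

Lemma modulusD (z w : C) : modulus (z + w) <= modulus z + modulus w.
Proof. exact: le_normcD. Qed.

Lemma modulusX (z : C) k : modulus (z ^+ k) = modulus z ^+ k.
Proof.
elim: k => [|k IH]; first by rewrite !expr0; exact: Normc.normc1.
by rewrite !exprS Normc.normcM IH.
Qed.

Lemma modulus_toC (x : R) : modulus (toC x) = `|x|.
Proof. by rewrite /= expr0n addr0 sqrtr_sqr. Qed.

(** The constant D in front of r ^ k satisfies l D + K <= r D, so the bound passes from k to k +
    1. *)
Lemma linear_recurrence_bound (x : nat -> R) (l r K : R) : 0 <= l -> l < r ->
  0 <= K -> (forall k, 0 <= x k) ->
  (forall k, x k.+1 <= l * x k + K * r ^+ k) ->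
  forall k, x k <= (x 0%N + K / (r - l)) * r ^+ k.
Proof.
move=> l0 lr K0 x0 xS; have rl0 : 0 < r - l by rewrite subr_gt0.
have r0 : 0 < r by exact: le_lt_trans lr.
set D := x 0%N + _; have KD : K <= (r - l) * D.
  by rewrite /D mulrDr mulrCA divff ?gt_eqF// mulr1 lerDr mulr_ge0// ltW.
elim=> [|k IH]; first by rewrite expr0 mulr1 lerDl divr_ge0// ltW.
apply: le_trans (xS k) _.
apply: (@le_trans _ _ (l * (D * r ^+ k) + (r - l) * D * r ^+ k)).
  by apply: lerD; rewrite ?ler_wpM2l// ler_wpM2r// exprn_ge0// ltW.
by rewrite le_eqVlt exprS; apply/orP; left; apply/eqP; ring.
Qed.

(** A substitute for the Jordan form, removing one factor at a time: W A^(k+1) = z W A^k + W (A - z)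
    A^k, where W (A - z) is annihilated by the remaining factors. *)
Lemma annihilated_growth n m (A : 'M[C]_n.+1) (s : seq C) (r : R) : 0 < r ->
  (forall z, z \in s -> modulus z < r) ->
  forall W : 'M[C]_(m, n.+1), W *m (\prod_(z <- s) (A - z%:M)) = 0 ->
  exists2 K, 0 <= K & forall k i j, modulus ((W *m A ^+ k) i j) <= K * r ^+ k.
Proof.
move=> r0; elim: s => [|z s IH] sr W.
  rewrite big_nil mulmx1 => ->; exists 0 => // k i j.
  by rewrite mul0mx mxE Normc.normc0 mul0r.
rewrite big_cons -mulmxE mulmxA => Wz.
have [|K K0 hK] := IH _ _ Wz.
  by move=> w ws; apply: sr; rewrite inE ws orbT.
have zr : modulus z < r by apply: sr; rewrite inE eqxx.
have rz : 0 < r - modulus z by rewrite subr_gt0.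
pose S := \sum_i \sum_j modulus (W i j).
have WS i j : modulus (W i j) <= S.
  rewrite /S (bigD1 i)//= (bigD1 j)//= -addrA lerDl addr_ge0//.
    by rewrite sumr_ge0// => *; exact: modulus_ge0.
  by rewrite sumr_ge0// => *; rewrite sumr_ge0// => *; exact: modulus_ge0.
have S0 : 0 <= S by rewrite sumr_ge0// => *; rewrite sumr_ge0// => *; exact: modulus_ge0.
exists (S + K / (r - modulus z)); first by rewrite addr_ge0// divr_ge0// ltW.
move=> k i j.
have := @linear_recurrence_bound (fun k => modulus ((W *m A ^+ k) i j)) (modulus z)
  r K (modulus_ge0 _) zr K0 (fun=> modulus_ge0 _) _ k.
move=> h; apply: le_trans (h _) _ => [k'|].
  have -> : W *m A ^+ k'.+1 = z *: (W *m A ^+ k') + W *m (A - z%:M) *m A ^+ k'.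
    rewrite exprS -mulmxE mulmxA mulmxBr mulmxBl mul_mx_scalar -scalemxAl.
    by rewrite addrC subrK.
  have addE (X Y : 'M[C]_(m, n.+1)) : (z *: X + Y) i j = z * X i j + Y i j.
    by rewrite !mxE.
  rewrite addE; apply: le_trans (modulusD _ _) _.
  by rewrite Normc.normcM lerD2l.
by rewrite ler_wpM2r ?exprn_ge0 ?(ltW r0)// lerD2r expr0 mulmx1.
Qed.

(** By Cayley-Hamilton, [annihilated_growth] applies to the identity matrix and the list of roots of
    the characteristic polynomial. *)
Lemma spectral_growth n (A : 'M[R]_n) (r : R) : 0 < r ->
  (forall z, eigenvalue (map_mx toC A) z -> modulus z < r) ->
  exists2 K, 0 <= K & forall k, `|A ^+ k| <= K * r ^+ k.
Proof.
case: n A => [|n] A r0 hr.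
  exists 0 => // k; rewrite mul0r; apply: mx_norm_le => // -[].
  by [].
pose B := map_mx toC A.
have [s /=] := closed_field_poly_normal (char_poly B).
rewrite (monicP (char_poly_monic B)) scale1r => pE.
have eB : 1%:M *m (\prod_(z <- s) (B - z%:M)) = 0.
  have := Cayley_Hamilton B; rewrite pE rmorph_prod /= mul1mx => <-.
  by apply: eq_bigr => z _; rewrite rmorphB /= horner_mx_X horner_mx_C.
have [|K K0 hK] := @annihilated_growth n _ B s r r0 _ _ eB.
  move=> z zs; apply: hr; rewrite eigenvalue_root_char pE.
  by rewrite root_prod_XsubC.
exists K => // k; apply: mx_norm_le => [|i j].
  by rewrite mulr_ge0 // exprn_ge0// ltW.
have := hK k i j; rewrite mul1mx.
have -> : B ^+ k = map_mx toC (A ^+ k) by rewrite rmorphXn.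
by rewrite mxE modulus_toC.
Qed.

(** The real and imaginary parts of a complex eigenvector grow at most like the eigenvector, and one
    of them is nonzero. *)
Lemma real_eigenvector_growth n (A : 'M[R]_n) z :
  eigenvalue (map_mx toC A) z ->
  exists v : 'rV[R]_n, v != 0 /\ exists2 K, 0 <= K &
    forall k, `|v *m A ^+ k| <= K * modulus z ^+ k.
Proof.
move=> /eigenvalueP[w wA w0].
have wAk k : w *m map_mx toC (A ^+ k) = z ^+ k *: w.
  elim: k => [|k IH]; first by rewrite !expr0 map_mx1 mulmx1 scale1r.
  by rewrite exprSr -mulmxE map_mxM mulmxA IH -scalemxAl wA scalerA exprSr.
pose K := \sum_j modulus (w 0 j).
have K0 : 0 <= K by rewrite sumr_ge0// => *; exact: modulus_ge0.
have wK j : modulus (w 0 j) <= K.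
  by rewrite /K (bigD1 j)//= lerDl sumr_ge0// => *; exact: modulus_ge0.
have part (p : C -> R) : (forall x y, p (x + y) = p x + p y) -> p 0 = 0 ->
    (forall x a, p (x * toC a) = p x * a) ->
    (forall x, `|p x| <= modulus x) ->
    forall k, `|map_mx p w *m A ^+ k| <= K * modulus z ^+ k.
  move=> pD p0 pM pb k.
  have -> : map_mx p w *m A ^+ k = map_mx p (z ^+ k *: w).
    rewrite -wAk; apply/matrixP => i j; rewrite !mxE.
    rewrite (big_morph p pD p0); apply: eq_bigr => l _.
    by rewrite !mxE pM.
  apply: mx_norm_le => [|i j]; first by rewrite mulr_ge0// exprn_ge0// modulus_ge0.
  rewrite !mxE; apply: le_trans (pb _) _.
  rewrite Normc.normcM modulusX mulrC ler_wpM2r ?exprn_ge0 ?modulus_ge0//.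
  by rewrite (ord1 i).
have [e|re0] := eqVneq (map_mx (@complex.Re R) w) 0; last first.
  exists (map_mx (@complex.Re R) w); split => //; exists K => // k; apply: part => //.
  - by move=> [? ?] [? ?].
  - by move=> [x y] a /=; rewrite mulr0 subr0.
  - by move=> [x y] /=; rewrite -sqrtr_sqr ler_wsqrtr// lerDl sqr_ge0.
exists (map_mx (@complex.Im R) w); split; last first.
  exists K => // k; apply: part => //.
  - by move=> [? ?] [? ?].
  - by move=> [x y] a /=; rewrite mulr0 add0r mulrC.
  - by move=> [x y] /=; rewrite -sqrtr_sqr ler_wsqrtr// lerDr sqr_ge0.
apply/eqP => e'; move/eqP: w0; apply; apply/matrixP => i j; rewrite mxE.
move/matrixP: e => /(_ i j); move/matrixP: e' => /(_ i j); rewrite !mxE.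
by case: (w i j) => x y /= -> ->.
Qed.

Lemma max_eigenvalue n (A : 'M[R]_n) z0 : eigenvalue (map_mx toC A) z0 ->
  exists z, [/\ eigenvalue (map_mx toC A) z, modulus z0 <= modulus z &
    forall y, eigenvalue (map_mx toC A) y -> modulus y <= modulus z].
Proof.
pose B := map_mx toC A; rewrite eigenvalue_root_char.
have [s /=] := closed_field_poly_normal (char_poly B).
rewrite (monicP (char_poly_monic B)) scale1r => pE.
have evE y : eigenvalue B y = (y \in s).
  by rewrite eigenvalue_root_char pE root_prod_XsubC.
rewrite -/B -eigenvalue_root_char evE => zs.
suff [z zs' hz] : exists2 z, z \in s & forall y, y \in s -> modulus y <= modulus z.
  by exists z; split; rewrite ?evE//; [exact: hz|move=> y; rewrite evE; exact: hz].
move: zs; clear; case: s => // a s _; elim: s a => [|b s IH] a.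
  by exists a; rewrite ?inE// => y; rewrite inE => /eqP ->.
have [z zs hz] := IH b.
have [az|za] := leP (modulus a) (modulus z).
  exists z; first by rewrite inE zs orbT.
  by move=> y; rewrite inE => /orP[/eqP->//|/hz].
exists a; first by rewrite inE eqxx.
move=> y; rewrite inE => /orP[/eqP->//|/hz /le_trans]; apply; exact: ltW.
Qed.

End SpectralGrowth.

(** * Contracted vectors in a semisimple Lie algebra *)

(** A subspace of maximal dimension among those contained in P is all of P: adjoining a further
    vector of P would raise the dimension. *)
Lemma vspace_of_pred (R : realType) n (P : 'rV[R]_n -> Prop) :
  P 0 -> (forall u v, P u -> P v -> P (u + v)) -> (forall a u, P u -> P (a *: u)) ->
  exists I : {vspace 'rV[R]_n}, forall v, v \in I <-> P v.
Proof.
move=> P0 PD PZ.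
pose D d := `[< exists I : {vspace 'rV[R]_n}, \dim I = d /\ forall v, v \in I -> P v >].
have exD : exists d, D d.
  exists 0%N; apply/asboolP; exists 0%VS; split; first by rewrite dimv0.
  by move=> v; rewrite memv0 => /eqP ->.
have bD d : D d -> (d <= \dim {:'rV[R]_n})%N.
  by move=> /asboolP[I [<- _]]; exact/dimvS/subvf.
have [d /asboolP[I [dI IP]] dmax] := ex_maxnP exD bD.
exists I => v; split; first exact: IP.
move=> Pv; apply: contrapT => /negP vI.
have := dmax (\dim (I + <[v]>)%VS); rewrite leqNgt -dI => /(_ _)/negP; apply.
  apply/asboolP; exists (I + <[v]>)%VS; split => // w /memv_addP[x xI [y /vlineP[a ->] ->]].
  by apply: PD; [exact: IP|exact: PZ].
rewrite ltn_neqAle dimvS ?addvSl// andbT; apply: contra vI => /eqP e.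
have /eqP -> : I == (I + <[v]>)%VS by rewrite eqEdim addvSl e leqnn.
by apply: (subvP (addvSr _ _)); exact: memv_line.
Qed.

Section Contracted.
Variables (R : realType) (n : nat) (A B : 'M[R]_n).
Hypothesis AB : A *m B = 1%:M.

Definition growth (r : R) (v : 'rV[R]_n) : Prop :=
  exists2 K, 0 <= K & forall k, `|v *m A ^+ k| <= K * r ^+ k.

Lemma growth0 r : 0 <= r -> growth r 0.
Proof. by move=> r0; exists 0 => // k; rewrite mul0mx normr0 mul0r. Qed.

Lemma growthD r u v : growth r u -> growth r v -> growth r (u + v).
Proof.
move=> [K K0 hK] [M M0 hM]; exists (K + M); first exact: addr_ge0.
by move=> k; rewrite mulmxDl mulrDl (le_trans (ler_normD _ _))// lerD.
Qed.

Lemma growthZ r a u : growth r u -> growth r (a *: u).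
Proof.
move=> [K K0 hK]; exists (`|a| * K); first exact: mulr_ge0.
by move=> k; rewrite -scalemxAl normrZ -mulrA ler_wpM2l.
Qed.

Lemma growth_le r s v : 0 <= r -> r <= s -> growth r v -> growth s v.
Proof.
move=> r0 rs [K K0 hK]; exists K => // k; apply: le_trans (hK k) _.
by rewrite ler_wpM2l// lerXn2r// nnegrE// (le_trans r0).
Qed.

Lemma le_geometric0 (x K q : R) : 0 <= q -> q < 1 ->
  (forall k, x <= K * q ^+ k) -> x <= 0.
Proof.
move=> q0 q1 xK.
have c : K * q ^+ k @[k --> \oo] --> K * 0.
  by apply: cvgM; [exact: cvg_cst|apply: cvg_expr; rewrite ger0_norm].
rewrite mulr0 in c.
rewrite -(cvg_lim (@Rhausdorff R) c); apply: limr_ge; first exact: (cvgP _ c).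
exact: nearW.
Qed.

(** An invertible matrix cannot contract too fast: v = v A^k B^k gives |v| <= K (n |B| r)^k for all
    k. *)
Lemma growth_small r v : 0 <= r -> n%:R * `|B| * r < 1 -> growth r v -> v = 0.
Proof.
move=> r0 r1 [K K0 hK]; apply/eqP; rewrite -normr_le0.
apply: (@le_geometric0 _ K (n%:R * `|B| * r)) => //; first by rewrite !mulr_ge0.
move=> k; have step j : `|v| <= (n%:R * `|B|) ^+ j * `|v *m A ^+ j|.
  elim: j => [|j IH]; first by rewrite !expr0 mul1r mulmx1.
  apply: le_trans IH _; rewrite exprSr -mulrA ler_wpM2l ?exprn_ge0 ?mulr_ge0//.
  have -> : v *m A ^+ j = v *m A ^+ j.+1 *m B.
    by rewrite exprSr -mulmxE mulmxA -mulmxA AB mulmx1.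
  by apply: le_trans (mulmx_norm_le _ _) _; rewrite mulrAC.
apply: le_trans (step k) _; rewrite [(_ * r) ^+ k]exprMn mulrCA.
by rewrite ler_wpM2l ?exprn_ge0 ?mulr_ge0.
Qed.

End Contracted.

Section Semisimple.
Variables (R : realType) (n : nat) (G : topologicalGroupType) (L : lie_group R n G).
Local Notation toC := (real_complex R).
Local Notation modulus := (@Normc.normc R).

Lemma lie_bracket_AdX x k X Y :
  lie_bracket L (X *m Ad L x ^+ k) (Y *m Ad L x ^+ k) =
  lie_bracket L X Y *m Ad L x ^+ k.
Proof.
elim: k => [|k IH]; first by rewrite !expr0 !mulmx1.
by rewrite !exprSr -!mulmxE !mulmxA lie_bracket_Ad IH.
Qed.

(** Ad preserves the bracket and the bracket is bounded, so rates multiply. *)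
Lemma lie_bracket_growth x r s X Y : growth (Ad L x) r X -> growth (Ad L x) s Y ->
  growth (Ad L x) (r * s) (lie_bracket L X Y).
Proof.
move=> [K K0 hK] [M M0 hM]; have [D D0 hD] := lie_bracket_bound L.
exists (D * K * M); first by rewrite !mulr_ge0.
move=> k; rewrite -lie_bracket_AdX; apply: le_trans (hD _ _) _.
have -> : D * K * M * (r * s) ^+ k = D * (K * r ^+ k) * (M * s ^+ k).
  by rewrite exprMn; ring.
by apply: ler_pM; rewrite ?mulr_ge0// ler_wpM2l.
Qed.

Lemma semisimple_eigenvalue_gt1 x : semisimple L ->
  (exists2 z, eigenvalue (map_mx toC (Ad L x)) z & modulus z != 1) ->
  exists2 z, eigenvalue (map_mx toC (Ad L x)) z & 1 < modulus z.
Proof.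
move=> ss [z0 ez0 z01]; apply: contrapT => no.
pose A := Ad L x; pose B := Ad L x^-1%g.
have AB : A *m B = 1%:M by exact: AdV.
have le1 z : eigenvalue (map_mx toC A) z -> modulus z <= 1.
  by move=> ez; rewrite leNgt; apply/negP => z1; apply: no; exists z.
have z0lt1 : modulus z0 < 1 by rewrite lt_neqAle z01 le1.
pose P v := exists r, [/\ 0 <= r, r < 1 & growth A r v].
have [I IP] : exists I : {vspace 'rV[R]_n}, forall v, v \in I <-> P v.
  apply: vspace_of_pred.
  - by exists 0; split => //; exact: growth0.
  - move=> u v [r [r0 r1 gu]] [s [s0 s1 gv]].
    exists (Num.max r s); split; rewrite ?le_max ?r0// ?gt_max ?r1//.
    by apply: growthD; [apply: growth_le gu|apply: growth_le gv];
      rewrite // le_max lexx ?orbT.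
  - by move=> a u [r [r0 r1 gu]]; exists r; split => //; exact: growthZ.
have gX r X : 1 < r -> growth A r X.
  move=> r1; have [||K K0 hK] := @spectral_growth _ _ A r.
  - exact: lt_trans ltr01 r1.
  - by move=> z /le1 z1; exact: le_lt_trans r1.
  exists (n%:R * `|X| * K) => [|k]; first by rewrite !mulr_ge0.
  by apply: le_trans (mulmx_norm_le _ _) _; rewrite -!mulrA !ler_wpM2l.
have ideal : lie_ideal L I.
  move=> X Y /IP[r [r0 r1 gY]]; apply/IP.
  have r1' : 0 < 1 + r by rewrite ltr_pwDl.
  (* All eigenvalues have modulus at most 1, so X grows at any rate above 1. The rate 2 / (1 + r) is
     chosen so that its product with r is still below 1. *)
  exists (2 / (1 + r) * r); split.
  - by rewrite mulr_ge0// divr_ge0// ltW.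
  - by rewrite mulrAC ltr_pdivrMr// mul1r; lra.
  - apply: lie_bracket_growth => //; apply: gX.
    by rewrite ltr_pdivlMr// mul1r; lra.
(* A finite basis of I gives one rate r0 < 1 for all of I. The rate is squared at each derivation,
   until [growth_small] leaves only 0. *)
have [r0 [r00 r01 hr0]] : exists r, [/\ 0 <= r, r < 1 & forall v, v \in I -> growth A r v].
  suff [r [r0 r1 hr]] : exists r, [/\ 0 <= r, r < 1 &
      forall v, v \in (vbasis I : seq _) -> growth A r v].
    exists r; split => // v vI; rewrite (coord_vbasis vI).
    apply: big_ind => [|u w|i _]; [exact: growth0|exact: growthD|].
    by apply/growthZ/hr; rewrite mem_nth// size_tuple.
  have : forall v, v \in (vbasis I : seq _) -> P v.
    by move=> v /vbasis_mem /IP.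
  elim: (vbasis I : seq _) => [_|v s IH hs]; first by exists 0; split.
  have [|r [r0 r1 hr]] := IH; first by move=> u us; apply: hs; rewrite inE us orbT.
  have [t [t0 t1 gt]] := hs v (mem_head _ _).
  exists (Num.max r t); split; rewrite ?le_max ?r0// ?gt_max ?r1//.
  move=> u; rewrite inE => /orP[/eqP ->|/hr gu].
    by apply: growth_le gt; rewrite // le_max lexx orbT.
  by apply: growth_le gu; rewrite // le_max lexx.
have der k v : v \in iter k (lie_derived L) I -> growth A (r0 ^+ (2 ^ k)) v.
  elim: k v => [|k IH] v /=; first by rewrite expn0 expr1; exact: hr0.
  set U := iter k _ I in IH *.
  have [J JP] : exists J : {vspace 'rV[R]_n},
      forall v, v \in J <-> growth A (r0 ^+ (2 ^ k.+1)) v.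
    by apply: vspace_of_pred => *; [exact/growth0/exprn_ge0|exact: growthD|exact: growthZ].
  suff /subvP h : (lie_derived L U <= J)%VS by move=> /h /JP.
  apply/span_subvP => w /allpairsP[[X Y] [/= Xb Yb ->]]; apply/JP.
  rewrite expnS mul2n -addnn exprD; apply: lie_bracket_growth; apply: IH.
    exact: vbasis_mem Xb.
  exact: vbasis_mem Yb.
have solv : lie_solvable L I.
  have [k hk] : exists k, n%:R * `|B| * r0 ^+ (2 ^ k) < 1.
    apply: contrapT => nk.
    have : (1 : R) <= 0.
      apply: (@le_geometric0 _ _ (n%:R * `|B|) r0) => // k.
      apply: le_trans (_ : n%:R * `|B| * r0 ^+ (2 ^ k) <= _).
        by rewrite leNgt; apply/negP => h; apply: nk; exists k.
      apply: ler_wpM2l; first by rewrite mulr_ge0.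
      by apply: ler_wiXn2l; rewrite ?(ltW r01) ?(ltnW (ltn_expl _ _)).
    by rewrite ler10.
  exists k; apply/eqP; rewrite -subv0; apply/subvP => v /der gv.
  rewrite memv0; apply/eqP; apply: (growth_small AB _ hk gv); exact: exprn_ge0.
have [v [v0 gv]] := real_eigenvector_growth ez0.
have : v \in I by apply/IP; exists (modulus z0); split => //; exact: modulus_ge0.
by rewrite (ss I ideal solv) memv0 (negbTE v0).
Qed.

End Semisimple.

(** * Nontriviality of the expanding horospherical subgroup *)

(** Iterating psi from u0 + s w_k follows the linear orbit u0 + s w_(k-j) with error at most E q^(2
    (k-j)). This allowance grows by the factor q^-2 at each step while A multiplies the error by at
    most beta < q^-2; the room [kappa] absorbs the quadratic error of psi. After k steps the orbit
    is near u0 + s w_0, away from u0. *)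
Lemma shadowing (R : realType) n (psi : 'rV[R]_n -> 'rV[R]_n) (u0 : 'rV[R]_n)
    (A : 'M[R]_n) (beta q M rho C : R) (w : nat -> 'rV[R]_n) :
  0 < q -> q <= 1 -> 0 <= beta -> beta * q ^+ 2 < 1 -> 0 <= M -> 0 < rho ->
  (forall u, `|u - u0| <= rho ->
     `|psi u - u0 - (u - u0) *m A| <= M * `|u - u0| ^+ 2) ->
  (forall x : 'rV[R]_n, `|x *m A| <= beta * `|x|) ->
  (forall k, w k.+1 *m A = w k) -> (forall k, `|w k| <= C * q ^+ k) ->
  w 0%N != 0 ->
  exists s eta, [/\ 0 < eta, (forall k j, (j <= k)%N ->
      `|iter j psi (u0 + s *: w k) - u0| <= rho * q ^+ (k - j)%N) &
    forall k, eta <= `|iter k psi (u0 + s *: w k) - u0|].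
Proof.
move=> q0 q1 b0 bq M0 rho0 hpsi hA wA wC w0.
have w0' : 0 < `|w 0%N| by rewrite normr_gt0.
have C0 : 0 < C by have := wC 0%N; rewrite expr0 mulr1; exact: lt_le_trans.
have q2 : 0 < q ^+ 2 by rewrite exprn_gt0.
pose kappa := (q ^+ 2)^-1 - beta.
have k0 : 0 < kappa by rewrite subr_gt0 -(ltr_pM2r q2) mulVf ?gt_eqF.
have small (X Y : R) : 0 <= X -> 0 < Y -> exists2 t, 0 < t &
    forall s, 0 <= s -> s <= t -> s * X <= Y.
  move=> X0 Y0; have X1 : 0 < X + 1 by rewrite ltr_wpDl.
  exists (Y / (X + 1)); first by rewrite divr_gt0.
  move=> s s0; rewrite ler_pdivlMr// => h; apply: le_trans h.
  by rewrite ler_wpM2l// lerDl.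
have C0' := ltW C0.
have X1 : 0 <= 4 * M * C by rewrite !mulr_ge0.
have X2 : 0 <= 2 * C by rewrite mulr_ge0.
have X3 : 0 <= 8 * M * C ^+ 2 by rewrite !mulr_ge0 ?exprn_ge0.
have [t1 t10 h1] := small _ _ X1 k0.
have [t2 t20 h2] := small _ _ X2 rho0.
have [t3 t30 h3] := small _ _ X3 (mulr_gt0 k0 w0').
(* With d = s C, the three bounds on s give E <= d, 2 d <= rho and E <= s |w_0| / 2, in the order
   t1, t2, t3. *)
pose s := Num.min t1 (Num.min t2 t3).
have s0 : 0 < s by rewrite !lt_min t10 t20 t30.
have {}h1 : s * (4 * M * C) <= kappa by apply: h1; rewrite ?(ltW s0)// !ge_min lexx.
have {}h2 : s * (2 * C) <= rho by apply: h2; rewrite ?(ltW s0)// !ge_min lexx ?orbT.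
have {}h3 : s * (8 * M * C ^+ 2) <= kappa * `|w 0%N|.
  by apply: h3; rewrite ?(ltW s0)// !ge_min lexx ?orbT.
have [d dE] : exists d, d = s * C by exists (s * C).
have d0 : 0 < d by rewrite dE mulr_gt0.
pose E := 4 * M * d ^+ 2 / kappa.
have E0 : 0 <= E.
  apply: divr_ge0; last exact: ltW.
  by apply: mulr_ge0; [apply: mulr_ge0|exact: sqr_ge0].
have kE : kappa * E = 4 * M * d ^+ 2 by rewrite /E mulrC divfK ?gt_eqF.
clearbody E.
have Ed : E <= d.
  rewrite -(ler_pM2l k0) kE expr2 !mulrA ler_wpM2r ?(ltW d0)//.
  by apply: le_trans h1; rewrite dE le_eqVlt; apply/orP; left; apply/eqP; ring.
have Ew : E <= s * `|w 0%N| / 2.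
  rewrite -(ler_pM2l k0) kE.
  apply: (@le_trans _ _ (s * (s * (8 * M * C ^+ 2)) / 2)).
    by rewrite dE le_eqVlt; apply/orP; left; apply/eqP; field.
  rewrite [leRHS]mulrA ler_wpM2r ?invr_ge0// [leRHS]mulrCA.
  by rewrite ler_wpM2l// ltW.
have drho : 2 * d <= rho by apply: le_trans h2; rewrite dE mulrCA.
have sw k : `|s *: w k| <= d * q ^+ k.
  by rewrite normrZ gtr0_norm// dE -mulrA ler_wpM2l// ltW.
have qk k : 0 <= q ^+ k by rewrite exprn_ge0// ltW.
have qk1 k : q ^+ k <= 1 by rewrite exprn_ile1// ltW.
have bound k x : `|x - u0 - s *: w k| <= E * (q ^+ k) ^+ 2 ->
    `|x - u0| <= 2 * d * q ^+ k.
  move=> xk; rewrite -[x - u0](subrK (s *: w k)).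
  apply: le_trans (ler_normD _ _) _; rewrite mulr2n mulrDl mul1r mulrDl lerD//.
  apply: le_trans xk _; apply: ler_pM => //; first exact: sqr_ge0.
  by rewrite expr2 ler_piMl.
have main k j : (j <= k)%N ->
    `|iter j psi (u0 + s *: w k) - u0 - s *: w (k - j)%N| <=
      E * (q ^+ (k - j)%N) ^+ 2.
  elim: j => [_|j IH jk].
    by rewrite subn0 /= (addrC u0) addrK subrr normr0 mulr_ge0 ?sqr_ge0.
  have {}IH := IH (ltnW jk); have xb := bound _ _ IH.
  move: IH xb; rewrite iterS; set x := iter j _ _ => IH xb.
  set N := (k - j.+1)%N; have NE : (k - j = N.+1)%N by rewrite /N subnS prednK// subn_gt0.
  rewrite NE in IH xb.
  have xrho : `|x - u0| <= rho.
    apply: le_trans xb _; apply: le_trans drho.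
    by rewrite ler_piMr// mulr_ge0// ltW.
  have -> : psi x - u0 - s *: w N =
      (psi x - u0 - (x - u0) *m A) + (x - u0 - s *: w N.+1) *m A.
    by rewrite (mulmxBl (x - u0)) -scalemxAl wA addrA subrK.
  apply: le_trans (ler_normD _ _) _.
  apply: (@le_trans _ _ (M * (2 * d * q ^+ N.+1) ^+ 2 + beta * (E * (q ^+ N.+1) ^+ 2))).
    apply: lerD.
      apply: le_trans (hpsi _ xrho) _; rewrite ler_wpM2l//.
      by apply: lerXn2r => //; rewrite nnegrE// !mulr_ge0// ltW.
    by apply: le_trans (hA _) _; rewrite ler_wpM2l.
  have -> : M * (2 * d * q ^+ N.+1) ^+ 2 + beta * (E * (q ^+ N.+1) ^+ 2) =
      (4 * M * d ^+ 2 + beta * E) * q ^+ 2 * (q ^+ N) ^+ 2.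
    by rewrite (exprS q N); ring.
  have -> : (4 * M * d ^+ 2 + beta * E) * q ^+ 2 = E.
    by rewrite -kE -mulrDl subrK mulrAC mulVf ?mul1r// gt_eqF.
  exact: lexx.
exists s, (s * `|w 0%N| / 2); split.
- by rewrite divr_gt0// mulr_gt0.
- move=> k j jk; apply: le_trans (bound _ _ (main k j jk)) _.
  by rewrite ler_wpM2r.
- move=> k; have := main k k (leqnn k); rewrite subnn expr0 expr1n mulr1.
  set x := iter k _ _ => xE.
  have : `|s *: w 0%N| <= `|x - u0| + `|x - u0 - s *: w 0%N|.
    by rewrite -{1}(subKr (x - u0) (s *: w 0%N)); exact: ler_normB.
  rewrite normrZ gtr0_norm//; move: xE Ew; lra.
Qed.

Lemma eigenvalue_inv (F : fieldType) n (A B : 'M[F]_n) z :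
  A *m B = 1%:M -> z != 0 -> eigenvalue A z -> eigenvalue B z^-1.
Proof.
move=> AB z0 /eigenvalueP[w wA w0]; apply/eigenvalueP; exists w => //.
have : w *m A *m B = w by rewrite -mulmxA AB mulmx1.
by rewrite wA -scalemxAl => {2}<-; rewrite scalerA mulVf// scale1r.
Qed.

Lemma mulmx_exprV (R : pzRingType) n (A B : 'M[R]_n) k :
  B *m A = 1%:M -> B ^+ k *m A ^+ k = 1%:M.
Proof.
move=> BA; elim: k => [|k IH]; first by rewrite !expr0 mulmx1.
by rewrite exprSr exprS -!mulmxE -mulmxA (mulmxA B) BA mul1mx.
Qed.

Section ExpandingPoint.
Variables (R : realType) (n : nat) (G : topologicalGroupType) (L : lie_group R n G).
Variable g : R -> G.
Hypothesis hg : one_parameter_subgroup g.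
Local Notation toC := (real_complex R).
Local Notation modulus := (@Normc.normc R).
Local Notation Phi := (conj_flow g).
Local Notation cm := (chart_map (chart_at L 1%g)).
Local Notation ci := (chart_inv (chart_at L 1%g)).
Local Notation u0 := (chart_map (chart_at L 1%g) 1%g).

Lemma annulus_compact m (x : 'rV[R]_m) (r s : R) :
  compact [set u | r <= `|u - x| <= s].
Proof.
have cn : continuous (fun u : 'rV[R]_m => `|u - x|).
  by move=> u; exact: (cvg_norm (cvgB cvg_id (cvg_cst x))).
apply: bounded_closed_compact.
  exists (`|x| + s); split; first exact: num_real.
  move=> M sM u /= /andP[_ us]; apply: le_trans (ltW sM).
  by rewrite -{1}(subrK x u) addrC (le_trans (ler_normD _ _))// lerD2l.
have -> : [set u | r <= `|u - x| <= s] = (fun u : 'rV[R]_m => `|u - x|) @^-1` `[r, s].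
  by apply/seteqP; split=> u /=; rewrite in_itv.
by apply: closed_comp => [u _|]; [exact: cn|exact: interval_closed].
Qed.

Lemma AdX k : Ad L (g k%:R) = Ad L (g 1) ^+ k.
Proof.
elim: k => [|k IH]; first by rewrite (one_parameter0 hg) Ad1.
by rewrite -natr1 hg.2 AdM IH exprS.
Qed.

Lemma conj_flow_unif (T : R) W : nbhs (1%g : G) W ->
  exists2 V, nbhs (1%g : G) V & forall r v, 0 <= r <= T -> V v -> W (Phi r v).
Proof.
move=> nW.
have : \forall v \near (1%g : G), `[0, T]%classic `<=` (fun r => W (Phi r v)).
  apply: (proj1 (compact_near_coveringP _) (@segment_compact R 0 T) _ _
    (fun v r => W (Phi r v))) => r _.
  have c : Phi x.1 x.2 @[x --> nbhs (r, (1%g : G))] --> Phi r 1%g.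
    by apply: cvg_conj_flow => //; [exact: cvg_fst|exact: cvg_snd].
  by apply: c; rewrite conj_flow1.
move=> h; exists [set v | `[0, T]%classic `<=` (fun r => W (Phi r v))] => //.
by move=> r v rT; apply; rewrite /= in_itv.
Qed.

(** Convergence along the multiples of m is enough: Phi over the remaining time, at most m, maps a
    neighbourhood of 1 uniformly into W. *)
Lemma horo_of_geometric (m : R) (K : nat -> set G) (p : G) : 0 < m ->
  (forall j, K j (Phi (j%:R * m) p)) ->
  (forall W, nbhs (1%g : G) W -> exists j0, forall j, (j0 <= j)%N -> K j `<=` W) ->
  expanding_horospherical g p.
Proof.
move=> m0 Kp KW W nW; have [V nV VW] := conj_flow_unif m nW.
have [j0 hj0] := KW _ nV.
exists (j0%:R * m); split; first exact: num_real.
move=> t jt; have t0 : 0 < t by apply: le_lt_trans jt; rewrite mulr_ge0// ltW.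
have [j /andP[jt1 jt2]] := nat_bracket m0 t0.
rewrite /= -(subrK (j%:R * m) t) conj_flowD//; apply: VW.
  by rewrite subr_ge0 (ltW jt1)/= lerBlDl -natr1 in jt2 *; move: jt2; lra.
apply: (hj0 j); last exact: Kp.
rewrite -ltnS -(ltr_nat R) -(ltr_pM2r m0); exact: lt_le_trans jt2.
Qed.

Lemma expanding_point : hausdorff_space G ->
  (exists2 z, eigenvalue (map_mx toC (Ad L (g 1))) z & 1 < modulus z) ->
  exists2 h, expanding_horospherical g h & h <> 1%g.
Proof.
move=> hG [z1 ez1 z11].
have [z [ez z1z zmax]] := max_eigenvalue ez1.
set A := Ad L (g 1) in ez zmax *; set mu := modulus z in z1z zmax.
have mu1 : 1 < mu by exact: lt_le_trans z1z.
have mu0 : 0 < mu by exact: lt_trans mu1.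
pose B := Ad L (g 1)^-1%g.
have AB : A *m B = 1%:M by exact: AdV.
have BA : B *m A = 1%:M by exact: AdVr.
have ezB : eigenvalue (map_mx toC B) z^-1.
  have z0 : z != 0.
    by apply/eqP => e; move: mu0; rewrite /mu e Normc.normc0 ltxx.
  by apply: eigenvalue_inv ez => //; rewrite -map_mxM AB map_mx1.
have [v [v0 [C C0 hC]]] := real_eigenvector_growth ezB.
pose r := (mu + mu ^+ 2) / 2.
have [mur rmu] : mu < r /\ r < mu ^+ 2.
  have : mu < mu ^+ 2 by rewrite expr2 ltr_pMr.
  by rewrite /r; split; lra.
have r0 : 0 < r by exact: lt_trans mur.
have [|K K0 hK] := @spectral_growth _ _ A r r0.
  by move=> y /zmax ym; exact: le_lt_trans mur.
have mu2 : 0 < mu ^+ 2 by rewrite exprn_gt0.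
have [m nKm] : exists m, n%:R * K * r ^+ m.+1 < (mu ^+ 2) ^+ m.+1.
  apply: contrapT => nm.
  have : (1 : R) <= 0.
    apply: (@le_geometric0 _ _ (n%:R * K * (r / mu ^+ 2)) (r / mu ^+ 2)).
    - by rewrite divr_ge0// ltW.
    - by rewrite ltr_pdivrMr// mul1r.
    - move=> k; have -> : n%:R * K * (r / mu ^+ 2) * (r / mu ^+ 2) ^+ k =
          n%:R * K * r ^+ k.+1 / (mu ^+ 2) ^+ k.+1.
        by rewrite -[RHS]mulrA -expr_div_n (exprS (r / mu ^+ 2)) !mulrA.
      rewrite ler_pdivlMr ?exprn_gt0// mul1r leNgt.
      by apply/negP => h; apply: nm; exists k.
  by rewrite ler10.
pose m1 := m.+1; pose beta := n%:R * K * r ^+ m1; pose q := (mu ^+ m1)^-1.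
have mum : 0 < mu ^+ m1 by rewrite exprn_gt0.
have q0 : 0 < q by rewrite invr_gt0.
have q1 : q < 1 by rewrite invf_lt1// exprn_egt1.
have beta0 : 0 <= beta by rewrite !mulr_ge0// exprn_ge0// ltW.
have bq : beta * q ^+ 2 < 1.
  by rewrite exprVn ltr_pdivrMr ?exprn_gt0// mul1r -exprM mulnC exprM.
pose Am := A ^+ m1.
have AmE : Ad L (g m1%:R) = Am by rewrite AdX.
have hAm (x : 'rV[R]_n) : `|x *m Am| <= beta * `|x|.
  apply: le_trans (mulmx_norm_le _ _) _.
  by rewrite /beta mulrAC -!mulrA ler_wpM2l// mulrA ler_wpM2r//; exact: hK.
(* The backward orbit of v under the power [Am]; v belongs to the eigenvalue z^-1 of the inverse,
   which gives the decay q ^ k. *)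
pose w k := v *m B ^+ (m1 * k).
have BAm : B ^+ m1 *m Am = 1%:M.
  exact: mulmx_exprV.
have wA k : w k.+1 *m Am = w k.
  by rewrite /w mulnS addnC exprD -mulmxE -!mulmxA BAm mulmx1.
have wC k : `|w k| <= C * q ^+ k.
  apply: le_trans (hC _) _; rewrite Normc.normcV -/mu.
  by rewrite exprM exprVn.
have w0 : w 0%N != 0 by rewrite /w muln0 expr0 mulmx1.
pose gm := g m1%:R.
have [M M0 hM] := conj_chart_quad L gm.
have nd := near_conj_dom L gm.
have ni : \forall u \near u0, chart_img (chart_at L 1%g) u.
  exact/nbhs_chart_img/img_u0.
have [e /= e0 he] : exists2 e : R, 0 < e & forall u, `|u - u0| < e ->
    [/\ chart_img (chart_at L 1%g) u,
        chart_dom (chart_at L 1%g) (gm * ci u * gm^-1)%g &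
     `|conj_chart L gm u - conj_chart L gm u0 - (u - u0) *m Ad L gm|
       <= M * `|u - u0| ^+ 2].
  have : \forall u \near u0, [/\ chart_img (chart_at L 1%g) u,
        chart_dom (chart_at L 1%g) (gm * ci u * gm^-1)%g &
     `|conj_chart L gm u - conj_chart L gm u0 - (u - u0) *m Ad L gm|
       <= M * `|u - u0| ^+ 2].
    by apply: filterS3 ni nd hM => u.
  move=> /nbhs_ballP[e /= e0 he]; exists e => // u ue; apply: he.
  by rewrite -ball_normE /= distrC.
pose rho := e / 2; have rho0 : 0 < rho by rewrite divr_gt0.
have rhoe u : `|u - u0| <= rho -> `|u - u0| < e.
  by move=> /le_lt_trans; apply; rewrite /rho; lra.
pose psi := conj_chart L gm.
have hpsi u : `|u - u0| <= rho ->
     `|psi u - u0 - (u - u0) *m Am| <= M * `|u - u0| ^+ 2.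
  by move=> /rhoe /he[_ _]; rewrite conj_chart_u0 -/gm AmE.
have [s [eta [eta0 orb far]]] :=
  shadowing q0 (ltW q1) beta0 bq M0 rho0 hpsi hAm wA wC w0.
pose x k j := iter j psi (u0 + s *: w k).
have qk1 k : q ^+ k <= 1 by rewrite exprn_ile1// ltW.
have xrho k j : (j <= k)%N -> `|x k j - u0| <= rho.
  by move=> jk; apply: le_trans (orb k j jk) _; rewrite ler_piMr// ltW.
(* Phi conjugates by the inverse of [gm], so it undoes psi. *)
have back u : `|u - u0| <= rho -> Phi m1%:R (ci (psi u)) = ci u.
  move=> /rhoe /he[_ ud _].
  rewrite /psi /conj_chart chart_mapK// /conj_flow (one_parameterN hg) -/gm.
  by rewrite !mulgA mulVg mul1g mulgVK.
pose p k := ci (x k k).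
have pj k j : (j <= k)%N -> Phi (j%:R * m1%:R) (p k) = ci (x k (k - j)%N).
  elim: j => [_|j IH jk]; first by rewrite mul0r conj_flow0// subn0.
  rewrite -natr1 mulrDl mul1r addrC conj_flowD// IH ?(ltnW jk)//.
  have -> : (k - j = (k - j.+1).+1)%N by rewrite subnS prednK// subn_gt0.
  by rewrite /x iterS back// xrho// leq_subr.
pose K_ (t : R) (j : nat) := ci @` [set u | t <= `|u - u0| <= rho * q ^+ j].
have cK t j : compact (K_ t j).
  apply: continuous_compact; last exact: annulus_compact.
  apply: continuous_subspaceW (@chart_inv_continuous _ _ _ (chart_at L 1%g)).
  move=> u /= /andP[_ ub].
  have urho : `|u - u0| <= rho.
    by apply: le_trans ub _; rewrite ler_piMr// ltW.
  by have [ui _ _] := he u (rhoe _ urho).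
(* The lower bound eta keeps the limit point h of the endpoints away from 1. For k >= j, Phi at time
   j m1 takes p_k into the closed set [K_ 0 j]; hence it takes h there too, and these sets shrink to
   1. *)
have [h [Kh ch]] : K_ eta 0%N `&` cluster (p k @[k --> \oo]) !=set0.
  apply: cK; exists 0%N => // k _; exists (x k k) => //=.
  by rewrite far/= expr0 mulr1 xrho.
exists h; last first.
  move=> h1; move: Kh; rewrite h1 => -[u /andP[u1 u2]].
  rewrite expr0 mulr1 in u2 => cu.
  have [ui _ _] := he u (rhoe _ u2).
  have uu : u = u0 by rewrite -(chart_invK ui) cu.
  by move: u1; rewrite uu subrr normr0 leNgt eta0.
apply: (@horo_of_geometric m1%:R (K_ 0)); first by rewrite ltr0n.
- move=> j; have := compact_closed hG (cK 0 j); apply => N nN.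
  have nN' : nbhs h (Phi (j%:R * m1%:R) @^-1` N).
    exact: (conj_flow_continuous hg nN).
  have pK : (p k @[k --> \oo]) (Phi (j%:R * m1%:R) @^-1` K_ 0 j).
    exists j => // k /= jk; rewrite /preimage /= pj//.
    exists (x k (k - j)%N) => //=; rewrite normr_ge0/=.
    by apply: le_trans (orb k (k - j)%N (leq_subr _ _)) _; rewrite subKn.
  by have [y [Ky Ny]] := ch _ _ pK nN'; exists (Phi (j%:R * m1%:R) y).
- move=> W nW; have /nbhs_ballP[d /= d0 hd] : nbhs u0 (ci @^-1` W).
    exact: (cvg_ci L nW).
  have [j0 hj0] : exists j0, rho * q ^+ j0 < d.
    apply: contrapT => nj; have : d <= 0.
      apply: (@le_geometric0 _ _ rho q); rewrite ?ltW// => k.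
      by rewrite leNgt; apply/negP => hk; apply: nj; exists k.
    by rewrite leNgt d0.
  exists j0 => j jj _ [u /= /andP[_ ub] <-]; apply: hd.
  rewrite -ball_normE /= distrC; apply: le_lt_trans hj0; apply: le_trans ub _.
  by rewrite ler_wpM2l ?(ltW rho0)// ler_wiXn2l ?(ltW q0)// ltW.
Qed.

End ExpandingPoint.

Unset Implicit Arguments.
Set Strict Implicit.

Theorem theorem1p2 (R : realType) (n : nat) (G : topologicalGroupType)
    (L : lie_group R n G) (Gamma : set G) (g : R -> G)
    (D0 : set G) (astar : R) :
  connected [set: G] ->
  semisimple L ->
  centerfree G ->
  no_compact_factors G ->
  irreducible_lattice R Gamma ->
  one_parameter_subgroup g ->
  ~ quasiunipotent L g ->
  admissible (expanding_horospherical g) D0 ->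
  msg_threshold (expanding_horospherical g) (conj_flow g) D0 astar ->
  exists2 a'' : R, 0 < a'' &
    forall (x z : coset_space Gamma) (a : R), a'' < a ->
      a_winning (expanding_horospherical g) (conj_flow g) D0 astar a
        [set h | expanding_horospherical g h /\ escaping g z (coset_translate h x)].
Proof.
move=> _ ss _ _ [[hGamma _] _] hg nqu hD0 _.
apply: escaping_a_winning => //; first exact: (lie_hausdorff L).
apply: (expanding_point hg (lie_hausdorff L)).
apply: (semisimple_eigenvalue_gt1 ss).
apply: contrapT => no; apply: nqu => z ez; rewrite modulusE.
have [->//|z1] := eqVneq (Normc.normc z) 1.
by case: no; exists z.
Qed.
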